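(* Let $z_0\in T$ and $k\in\{0,1,2,\dots\}\cup\{\infty\}$. Then $U_2(T,z_0,k)$ is a dense $G_\delta$ subset of $C^k(T)$.
   Context: $D=\{|z|<1\}$, $T=\{|z|=1\}$, $D(z_0,r)$ the open disk of center $z_0$ and radius $r$. For $k\in\{0,1,2,\dots\}\cup\{\infty\}$, $C^k(T)$ is the space of $u:T\to\mathbb{C}$ such that $\theta\mapsto u(e^{i\theta})$ is $k$ times continuously differentiable on $\mathbb{R}$, with the topology given by the seminorms $\sup_{\theta\in\mathbb{R}}|\frac{d^l}{d\theta^l}u(e^{i\theta})|$ for all integers $0\le l\le k$. For $z_0\in T$ and $r>0$ put $\Omega(z_0,r)=D(z_0,r)\cap\{|z|>1\}$. $U_2(T,z_0,k)$ is the set of $u\in C^k(T)$ for which there exist no $r>0$ and no continuous $\lambda:T\cup\Omega(z_0,r)\to\mathbb{C}$ holomorphic on $\Omega(z_0,r)$ with $\lambda=u$ on $D(z_0,r)\cap T$. *)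

(* Defs.v *)
From Stdlib Require Import Reals.
Open Scope R_scope.

Definition Cplx : Type := (R * R)%type.
Definition Cadd (z w : Cplx) : Cplx := (fst z + fst w, snd z + snd w).
Definition Csub (z w : Cplx) : Cplx := (fst z - fst w, snd z - snd w).
Definition Cmul (z w : Cplx) : Cplx :=
  (fst z * fst w - snd z * snd w, fst z * snd w + snd z * fst w).
Definition Cmod (z : Cplx) : R := sqrt (fst z ^ 2 + snd z ^ 2).

Definition expi (t : R) : Cplx := (cos t, sin t).

Definition onT (z : Cplx) : Prop := Cmod z = 1.
Definition Omega (z0 : Cplx) (r : R) (z : Cplx) : Prop :=
  Cmod (Csub z z0) < r /\ 1 < Cmod z.

(** Regularity index k in {0,1,2,...} U {infinity}: None = infinity. *)
Definition le_k (l : nat) (k : option nat) : Prop :=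
  match k with None => True | Some m => (l <= m)%nat end.

Definition Ccont_R (f : R -> Cplx) : Prop :=
  continuity (fun t => fst (f t)) /\ continuity (fun t => snd (f t)).
Definition Cderiv_R (f : R -> Cplx) (t : R) (d : Cplx) : Prop :=
  derivable_pt_lim (fun s => fst (f s)) t (fst d) /\
  derivable_pt_lim (fun s => snd (f s)) t (snd d).

Definition is_derseq (k : option nat) (f : R -> Cplx) (D : nat -> R -> Cplx) : Prop :=
  (forall t, D 0%nat t = f t) /\
  (forall l, le_k l k ->
     Ccont_R (D l) /\ (le_k (S l) k -> forall t, Cderiv_R (D l) t (D (S l) t))).

(** u : T -> Cplx (represented as u : Cplx -> Cplx, only values on T matter)
    belongs to Cplx^k(T): theta |-> u(e^{i theta}) is k times continuously
    differentiable on R. *)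
Definition Ck (k : option nat) (u : Cplx -> Cplx) : Prop :=
  exists D, is_derseq k (fun t => u (expi t)) D.

Definition Ck_close (k : option nat) (N : nat) (eps : R) (u v : Cplx -> Cplx) : Prop :=
  forall Du Dv, is_derseq k (fun t => u (expi t)) Du ->
                is_derseq k (fun t => v (expi t)) Dv ->
  forall l, (l <= N)%nat -> forall t, Cmod (Csub (Du l t) (Dv l t)) <= eps.

Definition Ck_open (k : option nat) (A : (Cplx -> Cplx) -> Prop) : Prop :=
  forall u, Ck k u -> A u ->
    exists N, le_k N k /\ exists eps, 0 < eps /\
      forall v, Ck k v -> Ck_close k N eps u v -> A v.

Definition Ck_dense (k : option nat) (U : (Cplx -> Cplx) -> Prop) : Prop :=
  (forall u, U u -> Ck k u) /\
  forall u, Ck k u -> forall N, le_k N k -> forall eps, 0 < eps ->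
    exists v, U v /\ Ck_close k N eps u v.

Definition Ck_Gdelta (k : option nat) (U : (Cplx -> Cplx) -> Prop) : Prop :=
  (forall u, U u -> Ck k u) /\
  exists A : nat -> (Cplx -> Cplx) -> Prop,
    (forall n, Ck_open k (A n)) /\
    (forall u, Ck k u -> (U u <-> forall n, A n u)).

Definition cont_within (S : Cplx -> Prop) (lam : Cplx -> Cplx) (z : Cplx) : Prop :=
  forall eps, 0 < eps -> exists delta, 0 < delta /\
    forall w, S w -> Cmod (Csub w z) < delta -> Cmod (Csub (lam w) (lam z)) < eps.

Definition holomorphic_on (S : Cplx -> Prop) (lam : Cplx -> Cplx) : Prop :=
  forall z, S z -> exists l : Cplx, forall eps, 0 < eps -> exists delta, 0 < delta /\
    forall w, S w -> Cmod (Csub w z) < delta ->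
      Cmod (Csub (Csub (lam w) (lam z)) (Cmul l (Csub w z))) <= eps * Cmod (Csub w z).

Definition U2 (z0 : Cplx) (k : option nat) (u : Cplx -> Cplx) : Prop :=
  Ck k u /\
  ~ (exists r, 0 < r /\ exists lam : Cplx -> Cplx,
        (forall z, (onT z \/ Omega z0 r z) ->
           cont_within (fun w => onT w \/ Omega z0 r w) lam z) /\
        holomorphic_on (Omega z0 r) lam /\
        (forall z, onT z -> Cmod (Csub z z0) < r -> lam z = u z)).

(* Main.v *)
(** If [u] extends across [z0] by some [lambda], then after shrinking [r] the extension is bounded, so
    the extendable functions are the union over [n] of the sets [E_n] of those having an extension
    to [Omega z0 (1/(n+1))] bounded by [n]. If [u] is a uniform limit of elements of [E_n], the
    two-constants theorem in a lens at [z0] makes the corresponding extensions uniformly Cauchy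
    near [z0], and their limit extends [u]. Hence no point of the closure of [E_n] lies in [U2], and
    [U2] is the intersection of the interiors of the complements of the [E_n].

    For density, add to an extendable [u] a small multiple of a smooth bump vanishing on one side of [z0]
    only. An extension of the bump would vanish outside the disc next to the arc where the
    bump is 0, hence in a disc tangent to the circle at a point where the bump is not 0.

    Complex differentiability is assumed only pointwise, so the maximum principle is derived from
    Goursat's bisection argument. *)
Require Import Defs.
From Stdlib Require Import Reals Lra Lia Psatz IndefiniteDescription ClassicalEpsilon Classical.
From Coquelicot Require Import Coquelicot.
Open Scope R_scope.

(** * Goursat's theorem on rectangles *)

(** All the function theory is drawn from one tool, a maximum principle on compact sets with one
    exceptional point at which continuity is enough. The exceptional point lets it act on difference
    quotients, which replaces the Cauchy integral formula in the convergence theorem. Two-constants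
    estimates come from applying it to products [h g^n]: a large [n] does what harmonic measure
    would do, so neither logarithms nor subharmonic functions appear, and [eps = 0] turns the
    estimate into a uniqueness theorem. The lens is bounded by arcs of two circles because
    [R / (z - p)] has constant modulus on a circle about [p]. An extension has to be continuous on
    the whole of [T], also far from [z0]; this is why a limit of extensions is defined as [u] on [T]
    and then restricted to a smaller radius. On the topological side, a limit of elements of [E_n]
    in the sup norm alone is already extendable, so one argument serves every [k]; derivatives
    matter only for density, through bounds on all derivatives of the bump. *)

Lemma pow_half_small (w d : R) : 0 < d -> exists n, w * (/ 2) ^ n < d.
Proof.
intros Hd.
assert (Hw : 0 < d / (Rabs w + 1)).
{ apply Rdiv_lt_0_compat; [assumption|]. pose proof (Rabs_pos w); lra. }
destruct (pow_lt_1_zero (/ 2) ltac:(rewrite Rabs_pos_eq; lra) _ Hw) as [n Hn].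
exists n. specialize (Hn n (le_n n)).
assert (Hp : 0 < (/ 2) ^ n) by (apply pow_lt; lra).
rewrite Rabs_pos_eq in Hn by lra.
apply Rle_lt_trans with ((Rabs w + 1) * (/ 2) ^ n).
- apply Rmult_le_compat_r; [lra|]. pose proof (Rle_abs w); lra.
- pose proof (Rabs_pos w).
  apply (Rmult_lt_compat_l (Rabs w + 1)) in Hn; [|lra].
  replace ((Rabs w + 1) * (d / (Rabs w + 1))) with d in Hn by (field; lra). lra.
Qed.

Lemma nested_point (x : nat -> R) (w : R) :
  0 <= w ->
  (forall n, x n <= x (S n) /\
     x (S n) + w * (/ 2) ^ (S n) <= x n + w * (/ 2) ^ n) ->
  exists l, forall n, x n <= l <= x n + w * (/ 2) ^ n.
Proof.
intros Hw Hx.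
assert (Hup : forall n m, x n <= x (n + m)%nat).
{ intros n m; induction m as [|m IH].
  - rewrite Nat.add_0_r; lra.
  - rewrite Nat.add_succ_r. pose proof (Hx (n + m)%nat); lra. }
assert (Hdn : forall n m, x (n + m)%nat + w * (/ 2) ^ (n + m) <= x n + w * (/ 2) ^ n).
{ intros n m; induction m as [|m IH].
  - rewrite Nat.add_0_r; lra.
  - rewrite Nat.add_succ_r. pose proof (Hx (n + m)%nat); lra. }
assert (Hp : forall n, 0 <= w * (/ 2) ^ n).
{ intros n. apply Rmult_le_pos; [assumption|]. apply pow_le; lra. }
assert (Hnm : forall n m, x n <= x m + w * (/ 2) ^ m).
{ intros n m.
  apply Rle_trans with (x (n + m)%nat); [apply Hup|].
  rewrite Nat.add_comm.
  pose proof (Hdn m n); pose proof (Hp (m + n)%nat); lra. }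
destruct (completeness (fun y => exists n, y = x n)) as [l [Hl1 Hl2]].
- exists (x 0%nat + w * (/ 2) ^ 0). intros y [n ->]. apply Hnm.
- exists (x 0%nat), 0%nat; reflexivity.
- exists l; intros n; split.
  + apply Hl1. exists n; reflexivity.
  + apply Hl2. intros y [m ->]. apply Hnm.
Qed.

(** Cousin's lemma for rectangles: if the conclusion failed, some quarter would fail again and
    again, and the nested failing rectangles would shrink to a point near which the property holds.
    It serves both Goursat's estimate and the existence of maxima on compact sets. *)
Lemma rect_induction (Pr : R -> R -> R -> R -> Prop) (a b c d : R) :
  a <= b -> c <= d ->
  (forall x1 x2 y1 y2, a <= x1 -> x1 <= x2 -> x2 <= b ->
     c <= y1 -> y1 <= y2 -> y2 <= d ->
     Pr x1 ((x1 + x2) / 2) y1 ((y1 + y2) / 2) ->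
     Pr ((x1 + x2) / 2) x2 y1 ((y1 + y2) / 2) ->
     Pr x1 ((x1 + x2) / 2) ((y1 + y2) / 2) y2 ->
     Pr ((x1 + x2) / 2) x2 ((y1 + y2) / 2) y2 ->
     Pr x1 x2 y1 y2) ->
  (forall x y, a <= x <= b -> c <= y <= d ->
     exists delta, 0 < delta /\ forall x1 x2 y1 y2,
       a <= x1 -> x1 <= x <= x2 -> x2 <= b -> c <= y1 -> y1 <= y <= y2 -> y2 <= d ->
       x2 - x1 < delta -> y2 - y1 < delta -> Pr x1 x2 y1 y2) ->
  Pr a b c d.
Proof.
intros Hab Hcd Hsplit Hloc.
destruct (classic (Pr a b c d)) as [H|Hbad]; [exact H|exfalso].
set (w := b - a). set (h := d - c).
set (q := fun n : nat => (/ 2) ^ n).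
set (bad := fun n (p : R * R) =>
  a <= fst p /\ fst p + w * q n <= b /\ c <= snd p /\ snd p + h * q n <= d /\
  ~ Pr (fst p) (fst p + w * q n) (snd p) (snd p + h * q n)).
assert (Hq : forall n, 0 < q n) by (intros n; apply pow_lt; lra).
assert (HqS : forall n, q (S n) = q n / 2) by (intros n; unfold q; simpl; field).
assert (Hwq : forall n, 0 <= w * q n).
{ intros n; apply Rmult_le_pos; [unfold w; lra|left; apply Hq]. }
assert (Hhq : forall n, 0 <= h * q n).
{ intros n; apply Rmult_le_pos; [unfold h; lra|left; apply Hq]. }
(* [bad] is a premise inside the existential, so that choice yields a total step function on pairs
   of a level and a lower left corner. *)
assert (Hstep : forall np : nat * (R * R), exists p',
  bad (fst np) (snd np) ->
  bad (S (fst np)) p' /\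
  fst (snd np) <= fst p' /\
  fst p' + w * q (S (fst np)) <= fst (snd np) + w * q (fst np) /\
  snd (snd np) <= snd p' /\
  snd p' + h * q (S (fst np)) <= snd (snd np) + h * q (fst np)).
{ intros [n [x y]]; simpl fst; simpl snd.
  destruct (classic (bad n (x, y))) as [B|B]; [|exists (x, y); tauto].
  pose proof (Hwq n) as H1. pose proof (Hhq n) as H2.
  unfold bad in B; simpl in B.
  destruct B as (B1 & B2 & B3 & B4 & B5).
  assert (E : exists p', ~ Pr (fst p') (fst p' + w * q (S n)) (snd p') (snd p' + h * q (S n)) /\
     (fst p' = x \/ fst p' = x + w * q (S n)) /\ (snd p' = y \/ snd p' = y + h * q (S n))).
  { apply NNPP; intros Hn. apply B5.
    assert (Hall : forall x' y', (x' = x \/ x' = x + w * q (S n)) -> (y' = y \/ y' = y + h * q (S n)) ->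
      Pr x' (x' + w * q (S n)) y' (y' + h * q (S n))).
    { intros x' y' Hx' Hy'. apply NNPP; intros Hn'. apply Hn. exists (x', y'); simpl; tauto. }
    rewrite HqS in Hall.
    apply Hsplit; try lra.
    - specialize (Hall x y).
      replace ((x + (x + w * q n)) / 2) with (x + w * (q n / 2)) by field.
      replace ((y + (y + h * q n)) / 2) with (y + h * (q n / 2)) by field. tauto.
    - specialize (Hall (x + w * (q n / 2)) y).
      replace ((x + (x + w * q n)) / 2) with (x + w * (q n / 2)) by field.
      replace ((y + (y + h * q n)) / 2) with (y + h * (q n / 2)) by field.
      replace (x + w * q n) with (x + w * (q n / 2) + w * (q n / 2)) by field. tauto.
    - specialize (Hall x (y + h * (q n / 2))).
      replace ((x + (x + w * q n)) / 2) with (x + w * (q n / 2)) by field.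
      replace ((y + (y + h * q n)) / 2) with (y + h * (q n / 2)) by field.
      replace (y + h * q n) with (y + h * (q n / 2) + h * (q n / 2)) by field. tauto.
    - specialize (Hall (x + w * (q n / 2)) (y + h * (q n / 2))).
      replace ((x + (x + w * q n)) / 2) with (x + w * (q n / 2)) by field.
      replace ((y + (y + h * q n)) / 2) with (y + h * (q n / 2)) by field.
      replace (x + w * q n) with (x + w * (q n / 2) + w * (q n / 2)) by field.
      replace (y + h * q n) with (y + h * (q n / 2) + h * (q n / 2)) by field. tauto. }
  destruct E as ([x' y'] & E1 & E2 & E3). simpl in *.
  exists (x', y'). intros _. unfold bad; simpl. rewrite HqS in *.
  repeat split; try assumption; destruct E2, E3; subst; nra. }
apply functional_choice in Hstep. destruct Hstep as [f Hf].
set (p := fix p n := match n with O => (a, c) | S m => f (m, p m) end).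
assert (Hp : forall n, bad n (p n)).
{ induction n as [|n IH].
  - unfold bad, q, w, h; simpl.
    rewrite !Rmult_1_r.
    replace (a + (b - a)) with b by ring. replace (c + (d - c)) with d by ring.
    repeat split; try lra; assumption.
  - apply (Hf (n, p n) IH). }
destruct (nested_point (fun n => fst (p n)) w ltac:(unfold w; lra)) as [x Hx].
{ intros n; destruct (Hf (n, p n) (Hp n)) as (_ & H1 & H2 & _); split; assumption. }
destruct (nested_point (fun n => snd (p n)) h ltac:(unfold h; lra)) as [y Hy].
{ intros n; destruct (Hf (n, p n) (Hp n)) as (_ & _ & _ & H1 & H2); split; assumption. }
destruct (Hloc x y) as [delta [Hd Hl]].
{ pose proof (Hx 0%nat). destruct (Hp 0%nat) as (? & ? & _). fold (q 0%nat) in *. lra. }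
{ pose proof (Hy 0%nat). destruct (Hp 0%nat) as (_ & _ & ? & ? & _). fold (q 0%nat) in *. lra. }
destruct (pow_half_small (w + h) delta Hd) as [n Hn]. fold (q n) in Hn.
destruct (Hp n) as (B1 & B2 & B3 & B4 & B5).
pose proof (Hx n) as Hxn. pose proof (Hy n) as Hyn. fold (q n) in Hxn, Hyn.
pose proof (Hwq n); pose proof (Hhq n).
apply B5, Hl; try assumption; lra.
Qed.

Lemma continuity_2d_pt_section1 (f : R -> R -> R) (x y : R) :
  continuity_2d_pt f x y -> continuous (fun u => f u y) x.
Proof.
intros H. apply continuity_pt_filterlim. intros eps Heps.
destruct (H (mkposreal eps Heps)) as [delta Hdelta].
exists delta; split; [apply cond_pos|].
intros u [_ Hu]. apply Hdelta; [exact Hu|].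
rewrite Rminus_diag, Rabs_R0; apply cond_pos.
Qed.

Lemma continuity_2d_pt_section2 (f : R -> R -> R) (x y : R) :
  continuity_2d_pt f x y -> continuous (fun v => f x v) y.
Proof.
intros H. apply continuity_pt_filterlim. intros eps Heps.
destruct (H (mkposreal eps Heps)) as [delta Hdelta].
exists delta; split; [apply cond_pos|].
intros v [_ Hv]. apply Hdelta; [|exact Hv].
rewrite Rminus_diag, Rabs_R0; apply cond_pos.
Qed.

(** The counterclockwise integral of [P dx + Q dy] over the boundary. Opposite sides share one
    integrand, so that the term linear in the running variable cancels at once. *)
Definition rect_integral (P Q : R -> R -> R) (x1 x2 y1 y2 : R) : R :=
  RInt (fun x => P x y1 - P x y2) x1 x2 + RInt (fun y => Q x2 y - Q x1 y) y1 y2.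

Lemma ex_RInt_sections (P Q : R -> R -> R) (a b c d : R) :
  (forall x y, a <= x <= b -> c <= y <= d ->
     continuity_2d_pt P x y /\ continuity_2d_pt Q x y) ->
  forall x1 x2 y1 y2, a <= x1 -> x1 <= x2 -> x2 <= b -> c <= y1 -> y1 <= y2 -> y2 <= d ->
  (forall y, c <= y <= d -> ex_RInt (fun x => P x y) x1 x2) /\
  (forall x, a <= x <= b -> ex_RInt (fun y => Q x y) y1 y2).
Proof.
intros Hc x1 x2 y1 y2 H1 H2 H3 H4 H5 H6. split; intros z Hz.
- apply (ex_RInt_continuous (V := R_CompleteNormedModule)).
  intros x Hx. rewrite Rmin_left, Rmax_right in Hx by lra.
  apply (continuity_2d_pt_section1 P), Hc; lra.
- apply (ex_RInt_continuous (V := R_CompleteNormedModule)).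
  intros y Hy. rewrite Rmin_left, Rmax_right in Hy by lra.
  apply (continuity_2d_pt_section2 Q), Hc; lra.
Qed.

Lemma rect_integral_expand (P Q : R -> R -> R) (x1 x2 y1 y2 : R) :
  ex_RInt (fun x => P x y1) x1 x2 -> ex_RInt (fun x => P x y2) x1 x2 ->
  ex_RInt (fun y => Q x1 y) y1 y2 -> ex_RInt (fun y => Q x2 y) y1 y2 ->
  rect_integral P Q x1 x2 y1 y2 =
  RInt (fun x => P x y1) x1 x2 - RInt (fun x => P x y2) x1 x2 +
  (RInt (fun y => Q x2 y) y1 y2 - RInt (fun y => Q x1 y) y1 y2).
Proof.
intros H1 H2 H3 H4. unfold rect_integral. f_equal.
- apply (RInt_minus (V := R_CompleteNormedModule)); assumption.
- apply (RInt_minus (V := R_CompleteNormedModule)); assumption.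
Qed.

(* Goursat's argument for a closed form [P dx + Q dy]: only pointwise
   differentiability is assumed, the partial derivatives need not be continuous. *)
Lemma goursat_closed_form (P Q : R -> R -> R) (a b c d : R) :
  a <= b -> c <= d ->
  (forall x y, a <= x <= b -> c <= y <= d -> exists p e q,
     differentiable_pt_lim P x y p e /\ differentiable_pt_lim Q x y e q) ->
  rect_integral P Q a b c d = 0.
Proof.
intros Hab Hcd Hdiff.
assert (Hcont : forall x y, a <= x <= b -> c <= y <= d ->
  continuity_2d_pt P x y /\ continuity_2d_pt Q x y).
{ intros x y Hx Hy. destruct (Hdiff x y Hx Hy) as (p & e & q & H1 & H2).
  split; apply differentiable_continuity_pt; [exists p, e|exists e, q]; assumption. }
pose proof (ex_RInt_sections P Q a b c d Hcont) as Hex.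
(* The bound is quadratic in the half-perimeter [S], so the bounds of the four quarters add up to
   exactly that of the whole: [4 (S/2)^2 = S^2]. *)
assert (Hest : forall eps, 0 < eps ->
  Rabs (rect_integral P Q a b c d) <= eps * ((b - a) + (d - c)) ^ 2).
{ intros eps Heps.
  apply (rect_induction (fun x1 x2 y1 y2 =>
    Rabs (rect_integral P Q x1 x2 y1 y2) <= eps * ((x2 - x1) + (y2 - y1)) ^ 2) a b c d Hab Hcd).
  - intros x1 x2 y1 y2 H1 H2 H3 H4 H5 H6 K1 K2 K3 K4.
    set (xm := (x1 + x2) / 2) in *. set (ym := (y1 + y2) / 2) in *.
    assert (Hxm : x1 <= xm <= x2) by (unfold xm; lra).
    assert (Hym : y1 <= ym <= y2) by (unfold ym; lra).
    destruct (Hex x1 xm y1 ym) as [A1 B1]; try lra.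
    destruct (Hex xm x2 ym y2) as [A2 B2]; try lra.
    destruct (Hex x1 x2 y1 y2) as [A3 B3]; try lra.
    rewrite rect_integral_expand in K1 by (first [apply A1 | apply B1]; lra).
    rewrite rect_integral_expand in K2 by (first [apply A2 | apply B1]; lra).
    rewrite rect_integral_expand in K3 by (first [apply A1 | apply B2]; lra).
    rewrite rect_integral_expand in K4 by (first [apply A2 | apply B2]; lra).
    rewrite rect_integral_expand by (first [apply A3 | apply B3]; lra).
    rewrite <- (RInt_Chasles (V := R_CompleteNormedModule) (fun x => P x y1) x1 xm x2) by (apply A1 || apply A2; lra).
    rewrite <- (RInt_Chasles (V := R_CompleteNormedModule) (fun x => P x y2) x1 xm x2) by (apply A1 || apply A2; lra).
    rewrite <- (RInt_Chasles (V := R_CompleteNormedModule) (fun y => Q x1 y) y1 ym y2) by (apply B1 || apply B2; lra).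
    rewrite <- (RInt_Chasles (V := R_CompleteNormedModule) (fun y => Q x2 y) y1 ym y2) by (apply B1 || apply B2; lra).
    unfold plus; cbn -[pow RInt].
    replace (eps * (x2 - x1 + (y2 - y1)) ^ 2) with
      (eps * (xm - x1 + (ym - y1)) ^ 2 + eps * (x2 - xm + (ym - y1)) ^ 2 +
       eps * (xm - x1 + (y2 - ym)) ^ 2 + eps * (x2 - xm + (y2 - ym)) ^ 2)
      by (unfold xm, ym; field).
    match goal with |- Rabs ?X <= _ =>
      match type of K1 with Rabs ?E1 <= _ =>
      match type of K2 with Rabs ?E2 <= _ =>
      match type of K3 with Rabs ?E3 <= _ =>
      match type of K4 with Rabs ?E4 <= _ =>
        replace X with (E1 + E2 + E3 + E4) by ring;
        pose proof (Rabs_triang (E1 + E2 + E3) E4);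
        pose proof (Rabs_triang (E1 + E2) E3);
        pose proof (Rabs_triang E1 E2)
      end end end end
    end. lra.
  - intros x y Hx Hy.
    destruct (Hdiff x y Hx Hy) as (p & e & q & DP & DQ).
    assert (He2 : 0 < eps / 2) by lra.
    destruct (DP (mkposreal _ He2)) as [d1 Hd1].
    destruct (DQ (mkposreal _ He2)) as [d2 Hd2].
    exists (Rmin d1 d2). split; [apply Rmin_pos; apply cond_pos|].
    intros x1 x2 y1 y2 H1 H2 H3 H4 H5 H6 Hw Hh.
    pose proof (Rmin_l d1 d2). pose proof (Rmin_r d1 d2).
    destruct (Hex x1 x2 y1 y2) as [A B]; try lra.
    set (S := (x2 - x1) + (y2 - y1)).
    assert (HP : forall u v, x1 <= u <= x2 -> y1 <= v <= y2 ->
      Rabs (P u v - P x y - (p * (u - x) + e * (v - y))) <= eps / 2 * S).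
    { intros u v Hu Hv.
      apply Rle_trans with (eps / 2 * Rmax (Rabs (u - x)) (Rabs (v - y))).
      - apply (Hd1 u v); apply Rabs_def1; lra.
      - apply Rmult_le_compat_l; [lra|].
        apply Rmax_lub; apply Rabs_le; unfold S; lra. }
    assert (HQ : forall u v, x1 <= u <= x2 -> y1 <= v <= y2 ->
      Rabs (Q u v - Q x y - (e * (u - x) + q * (v - y))) <= eps / 2 * S).
    { intros u v Hu Hv.
      apply Rle_trans with (eps / 2 * Rmax (Rabs (u - x)) (Rabs (v - y))).
      - apply (Hd2 u v); apply Rabs_def1; lra.
      - apply Rmult_le_compat_l; [lra|].
        apply Rmax_lub; apply Rabs_le; unfold S; lra. }
    assert (exP : ex_RInt (fun x => P x y1 - P x y2) x1 x2).
    { apply (ex_RInt_minus (V := R_NormedModule)); apply A; lra. }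
    assert (exQ : ex_RInt (fun y => Q x2 y - Q x1 y) y1 y2).
    { apply (ex_RInt_minus (V := R_NormedModule)); apply B; lra. }
    (* The two contributions of the common cross derivative [e] cancel: [(x2 - x1) e (y1 - y2) + (y2
       - y1) e (x2 - x1) = 0]. The integrands that remain are bounded by [eps * S]. *)
    assert (E : rect_integral P Q x1 x2 y1 y2 =
      RInt (fun x => P x y1 - P x y2 - e * (y1 - y2)) x1 x2 +
      RInt (fun y => Q x2 y - Q x1 y - e * (x2 - x1)) y1 y2).
    { unfold rect_integral.
      rewrite (RInt_minus (V := R_CompleteNormedModule) (fun x => P x y1 - P x y2) (fun _ => e * (y1 - y2)));
        [|exact exP|apply ex_RInt_const].
      rewrite (RInt_minus (V := R_CompleteNormedModule) (fun y => Q x2 y - Q x1 y) (fun _ => e * (x2 - x1)));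
        [|exact exQ|apply ex_RInt_const].
      rewrite !RInt_const.
      unfold minus, plus, opp, scal; simpl. unfold mult; simpl. ring. }
    rewrite E.
    assert (I1 : Rabs (RInt (fun x => P x y1 - P x y2 - e * (y1 - y2)) x1 x2) <= (x2 - x1) * (eps * S)).
    { apply abs_RInt_le_const; [lra| |].
      - apply (ex_RInt_minus (V := R_NormedModule)); [exact exP|apply ex_RInt_const].
      - intros t Ht. pose proof (HP t y1 Ht ltac:(lra)) as E1.
        pose proof (HP t y2 Ht ltac:(lra)) as E2.
        apply Rabs_le_between in E1. apply Rabs_le_between in E2.
        apply Rabs_le. lra. }
    assert (I2 : Rabs (RInt (fun y => Q x2 y - Q x1 y - e * (x2 - x1)) y1 y2) <= (y2 - y1) * (eps * S)).
    { apply abs_RInt_le_const; [lra| |].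
      - apply (ex_RInt_minus (V := R_NormedModule)); [exact exQ|apply ex_RInt_const].
      - intros t Ht. pose proof (HQ x1 t ltac:(lra) Ht) as E1.
        pose proof (HQ x2 t ltac:(lra) Ht) as E2.
        apply Rabs_le_between in E1. apply Rabs_le_between in E2.
        apply Rabs_le. lra. }
    eapply Rle_trans; [apply Rabs_triang|].
    replace (eps * S ^ 2) with ((x2 - x1) * (eps * S) + (y2 - y1) * (eps * S)) by (unfold S; ring).
    lra. }
set (L := ((b - a) + (d - c)) ^ 2) in *.
assert (HL : 0 <= L) by (apply pow2_ge_0).
destruct (Req_dec (rect_integral P Q a b c d) 0) as [|Hne]; [assumption|].
apply Rabs_pos_lt in Hne.
set (v := Rabs (rect_integral P Q a b c d)) in *.
assert (0 < v / (2 * (L + 1))) by (apply Rdiv_lt_0_compat; lra).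
pose proof (Hest _ H) as K.
assert (v / (2 * (L + 1)) * L <= v / 2).
{ apply Rmult_le_reg_r with (2 * (L + 1)); [lra|].
  replace (v / (2 * (L + 1)) * L * (2 * (L + 1))) with (v * L) by (field; lra). nra. }
lra.
Qed.

(** * The mean value property *)

Definition holo_at (f : C -> C) (z : C) : Prop :=
  ex_derive (K := C_AbsRing) (V := AbsRing_NormedModule C_AbsRing) f z.

Lemma is_derive_C_iff (f : C -> C) (z l : C) :
  is_derive (K := C_AbsRing) (V := AbsRing_NormedModule C_AbsRing) f z l <->
  forall eps, 0 < eps -> exists delta, 0 < delta /\ forall w,
    Cmod (w - z) < delta ->
    Cmod (f w - f z - l * (w - z))%C <= eps * Cmod (w - z).
Proof.
split.
- intros [_ H] eps Heps.
  destruct (H z (fun P HP => HP) (mkposreal eps Heps)) as [delta Hd].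
  exists delta; split; [apply cond_pos|]. intros w Hw.
  specialize (Hd w Hw).
  rewrite (Cmult_comm l). exact Hd.
- intros H. split; [apply is_linear_scal_l|].
  intros x Hx. apply (is_filter_lim_locally_unique (K := C_AbsRing) (V := AbsRing_NormedModule C_AbsRing)) in Hx. subst x.
  intros [eps Heps]. destruct (H eps Heps) as [delta [Hd Hd']].
  exists (mkposreal delta Hd). intros w Hw.
  specialize (Hd' w Hw). rewrite (Cmult_comm l) in Hd'. exact Hd'.
Qed.

Lemma holo_at_mult (f g : C -> C) (z : C) :
  holo_at f z -> holo_at g z -> holo_at (fun w => f w * g w)%C z.
Proof.
intros [l Hl] [m Hm]. eexists.
apply (is_derive_mult (K := C_AbsRing) f g z l m Hl Hm Cmult_comm).
Qed.

Lemma holo_at_plus (f g : C -> C) (z : C) :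
  holo_at f z -> holo_at g z -> holo_at (fun w => f w + g w)%C z.
Proof.
intros [l Hl] [m Hm]. eexists.
apply (is_derive_plus (K := C_AbsRing) (V := AbsRing_NormedModule C_AbsRing) f g z l m Hl Hm).
Qed.

Lemma holo_at_const (c z : C) : holo_at (fun _ => c) z.
Proof.
eexists. apply (is_derive_const (K := C_AbsRing) (V := AbsRing_NormedModule C_AbsRing) c).
Qed.

Lemma holo_at_id (z : C) : holo_at (fun w => w) z.
Proof. eexists. apply (is_derive_id (K := C_AbsRing)). Qed.

Lemma holo_at_ext_loc (f g : C -> C) (z : C) (d : R) : 0 < d ->
  (forall w, Cmod (w - z) < d -> f w = g w) -> holo_at f z -> holo_at g z.
Proof.
intros Hd Hfg [l Hl]. exists l.
eapply is_derive_ext_loc; [|exact Hl].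
exists (mkposreal d Hd). exact Hfg.
Qed.

Lemma holo_at_inv (a z : C) : z <> a -> holo_at (fun w => / (w - a))%C z.
Proof.
intros Hz. exists (- / ((z - a) * (z - a)))%C.
apply is_derive_C_iff. intros eps Heps.
assert (Hza : (z - a <> 0)%C).
{ intros H. apply Hz. replace z with (z - a + a)%C by ring. rewrite H. ring. }
set (m := Cmod (z - a)).
assert (Hm : 0 < m) by (apply Cmod_gt_0; exact Hza).
exists (Rmin (m / 2) (eps * m ^ 3 / 2)). split.
{ apply Rmin_pos; [lra|]. assert (0 < m ^ 3) by (apply pow_lt; lra). nra. }
intros w Hw.
pose proof (Rmin_l (m / 2) (eps * m ^ 3 / 2)). pose proof (Rmin_r (m / 2) (eps * m ^ 3 / 2)).
assert (Hwa : m / 2 < Cmod (w - a)).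
{ pose proof (Cmod_triangle (w - a) (- (w - z))) as T.
  replace (w - a + - (w - z))%C with (z - a)%C in T by ring.
  rewrite Cmod_opp in T. fold m in T. lra. }
assert (Hwa0 : (w - a <> 0)%C) by (apply Cmod_gt_0; lra).
replace (/ (w - a) - / (z - a) - - / ((z - a) * (z - a)) * (w - z))%C
  with ((w - z) * (w - z) / ((w - a) * ((z - a) * (z - a))))%C
  by (field; tauto).
rewrite Cmod_div by (repeat apply Cmult_neq_0; assumption).
rewrite !Cmod_mult. fold m. set (x := Cmod (w - z)) in *. set (y := Cmod (w - a)) in *.
assert (0 <= x) by (apply Cmod_ge_0).
assert (0 < m * m) by nra.
apply Rmult_le_reg_r with (y * (m * m)); [apply Rmult_lt_0_compat; lra|].
replace (x * x / (y * (m * m)) * (y * (m * m))) with (x * x) by (field; lra).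
replace (eps * x * (y * (m * m))) with (x * (eps * (y * (m * m)))) by ring.
apply Rmult_le_compat_l; [assumption|].
apply Rle_trans with (eps * m ^ 3 / 2); [lra|].
replace (eps * m ^ 3 / 2) with (eps * (m / 2 * (m * m))) by field.
apply Rmult_le_compat_l; [lra|]. apply Rmult_le_compat_r; lra.
Qed.

Lemma holo_at_pow (f : C -> C) (n : nat) (z : C) :
  holo_at f z -> holo_at (fun w => Cpow (f w) n) z.
Proof.
intros H. induction n as [|n IH]; simpl.
- apply holo_at_const.
- apply holo_at_mult; assumption.
Qed.

Lemma holo_at_minus (f g : C -> C) (z : C) :
  holo_at f z -> holo_at g z -> holo_at (fun w => f w - g w)%C z.
Proof.
intros Hf Hg. apply (holo_at_ext_loc (fun w => f w + (- (1)) * g w)%C _ _ 1); [lra|intros; ring|].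
apply holo_at_plus; [assumption|]. apply holo_at_mult; [apply holo_at_const|assumption].
Qed.

Lemma Cmod_le_abs2 (z : C) : Cmod z <= Rabs (fst z) + Rabs (snd z).
Proof.
destruct z as [x y]; unfold Cmod; simpl fst; simpl snd.
apply Rsqr_incr_0_var; [|pose proof (Rabs_pos x); pose proof (Rabs_pos y); lra].
rewrite Rsqr_sqrt by nra. unfold Rsqr.
pose proof (Rabs_pos x); pose proof (Rabs_pos y).
assert (Rabs x * Rabs x = x * x) by (rewrite <- Rabs_mult; apply Rabs_pos_eq; nra).
assert (Rabs y * Rabs y = y * y) by (rewrite <- Rabs_mult; apply Rabs_pos_eq; nra).
nra.
Qed.

Lemma Rabs_snd_le (z : C) : Rabs (snd z) <= Cmod z.
Proof. eapply Rle_trans; [apply Rmax_r|apply Rmax_Cmod]. Qed.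

Lemma Rabs_fst_le (z : C) : Rabs (fst z) <= Cmod z.
Proof. apply re_le_Cmod. Qed.

Lemma Cmod_sqr (z : C) : Cmod z ^ 2 = fst z ^ 2 + snd z ^ 2.
Proof. apply Cmod2_alt. Qed.

Lemma is_derive_C_cauchy_riemann (f : C -> C) (z l : C) :
  is_derive (K := C_AbsRing) (V := AbsRing_NormedModule C_AbsRing) f z l ->
  differentiable_pt_lim (fun x y => fst (f (x, y))) (fst z) (snd z) (fst l) (- snd l) /\
  differentiable_pt_lim (fun x y => snd (f (x, y))) (fst z) (snd z) (snd l) (fst l).
Proof.
intros H.
assert (K : forall eps : posreal, exists delta : posreal, forall u v,
  Rabs (u - fst z) < delta -> Rabs (v - snd z) < delta ->
  Cmod (f (u, v) - f (fst z, snd z) - l * ((u, v) - z))%C <= eps * Rmax (Rabs (u - fst z)) (Rabs (v - snd z))).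
{ intros eps. destruct (proj1 (is_derive_C_iff f z l) H (eps / 2)) as [delta [Hd K]].
  { apply Rdiv_lt_0_compat; [apply cond_pos|lra]. }
  assert (Hd2 : 0 < delta / 2) by lra.
  exists (mkposreal _ Hd2). simpl. intros u v Hu Hv.
  rewrite <- surjective_pairing.
  assert (B : Cmod ((u, v) - z) <= Rabs (u - fst z) + Rabs (v - snd z)).
  { apply (Cmod_le_abs2 ((u, v) - z)%C). }
  eapply Rle_trans; [apply K; lra|].
  pose proof (Rmax_l (Rabs (u - fst z)) (Rabs (v - snd z))).
  pose proof (Rmax_r (Rabs (u - fst z)) (Rabs (v - snd z))).
  pose proof (cond_pos eps). nra. }
split; intros eps; destruct (K eps) as [delta Hd]; exists delta; intros u v Hu Hv;
  (eapply Rle_trans; [|apply (Hd u v Hu Hv)]).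
- eapply Rle_trans; [|apply Rabs_fst_le].
  right. f_equal. simpl. ring.
- eapply Rle_trans; [|apply Rabs_snd_le].
  right. f_equal. simpl. ring.
Qed.

Definition cont_at (f : C -> C) (z : C) : Prop :=
  forall eps, 0 < eps -> exists delta, 0 < delta /\ forall w,
    Cmod (w - z) < delta -> Cmod (f w - f z) < eps.

Lemma holo_at_cont_at (f : C -> C) (z : C) : holo_at f z -> cont_at f z.
Proof.
intros [l Hl] eps Heps.
destruct (proj1 (is_derive_C_iff f z l) Hl 1 ltac:(lra)) as [d [Hd H]].
pose proof (Cmod_ge_0 l).
exists (Rmin d (eps / (Cmod l + 2))).
assert (0 < eps / (Cmod l + 2)) by (apply Rdiv_lt_0_compat; lra).
split; [apply Rmin_pos; assumption|].
intros w Hw.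
pose proof (Rmin_l d (eps / (Cmod l + 2))). pose proof (Rmin_r d (eps / (Cmod l + 2))).
specialize (H w ltac:(lra)).
pose proof (Cmod_triangle (f w - f z - l * (w - z)) (l * (w - z))) as T.
replace (f w - f z - l * (w - z) + l * (w - z))%C with (f w - f z)%C in T by ring.
rewrite Cmod_mult in T.
assert (K : Cmod (w - z) * (Cmod l + 2) < eps).
{ apply Rlt_le_trans with (eps / (Cmod l + 2) * (Cmod l + 2)).
  - apply Rmult_lt_compat_r; lra.
  - right; field; lra. }
pose proof (Cmod_ge_0 (w - z)). nra.
Qed.

Definition polar (a : C) (s t : R) : C := (fst a + exp s * cos t, snd a + exp s * sin t).

(** With [h] equal to [cos] or [sin] this differentiates a coordinate of [polar], hence the
    integrand of a circular mean by the chain rule. *)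
Lemma differentiable_exp_mult (h h' : R -> R) (c s t : R) :
  derivable_pt_lim h t (h' t) ->
  differentiable_pt_lim (fun u v => c + exp u * h v) s t (exp s * h t) (exp s * h' t).
Proof.
intros Hh. apply filterdiff_differentiable_pt_lim.
assert (H1 : filterdiff (fun u : R * R => exp (fst u)) (locally (s, t)) (fun u => scal (fst u) (exp s))).
{ apply (filterdiff_comp' fst exp (s, t) fst (fun y => scal y (exp s))).
  - apply filterdiff_linear, is_linear_fst.
  - apply is_derive_Reals, derivable_pt_lim_exp. }
assert (H2 : filterdiff (fun u : R * R => h (snd u)) (locally (s, t)) (fun u => scal (snd u) (h' t))).
{ apply (filterdiff_comp' snd h (s, t) snd (fun y => scal y (h' t))).
  - apply filterdiff_linear, is_linear_snd.
  - apply is_derive_Reals, Hh. }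
eapply filterdiff_ext_lin.
- apply (filterdiff_plus_fct (V := R_NormedModule)).
  + apply filterdiff_const.
  + apply (filterdiff_mult_fct (K := R_AbsRing) (fun u : R * R => exp (fst u)) (fun u : R * R => h (snd u)) (s, t)).
    * apply Rmult_comm.
    * apply H1.
    * apply H2.
- intros [u v]; simpl. unfold plus, mult, scal, zero; simpl. unfold mult; simpl. ring.
Qed.

Lemma Cmod_polar (a : C) (s t : R) : Cmod (polar a s t - a) = exp s.
Proof.
unfold Cmod, polar; simpl fst; simpl snd.
replace ((fst a + exp s * cos t + - fst a) ^ 2 + (snd a + exp s * sin t + - snd a) ^ 2)
  with (exp s ^ 2 * (Rsqr (sin t) + Rsqr (cos t))) by (unfold Rsqr; ring).
rewrite sin2_cos2, Rmult_1_r. apply sqrt_pow2. left; apply exp_pos.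
Qed.

(* With [f = U + iV] in the coordinates [z = a + e^(s + it)], the Cauchy-Riemann equations
   say that [V ds + U dt] is closed; Goursat on [s0,s1] x [0,2PI] compares two circular means. *)
Lemma circle_mean_const (f : C -> C) (a : C) (r s0 s1 : R) :
  (forall z, 0 < Cmod (z - a) < r -> holo_at f z) ->
  s0 <= s1 -> exp s1 < r ->
  RInt (fun t => fst (f (polar a s0 t))) 0 (2 * PI) =
  RInt (fun t => fst (f (polar a s1 t))) 0 (2 * PI).
Proof.
intros Hf Hs Hr. pose proof PI_RGT_0 as HPI.
set (U := fun s t => fst (f (polar a s t))).
set (V := fun s t => snd (f (polar a s t))).
assert (Hd : forall s t, s0 <= s <= s1 -> 0 <= t <= 2 * PI -> exists p e q,
  differentiable_pt_lim V s t p e /\ differentiable_pt_lim U s t e q).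
{ intros s t Hst _.
  destruct (Hf (polar a s t)) as [l Hl].
  { rewrite Cmod_polar. split; [apply exp_pos|].
    apply Rle_lt_trans with (exp s1); [|assumption].
    destruct (Rle_lt_or_eq_dec s s1 ltac:(lra)) as [H|H];
      [left; apply exp_increasing; assumption|subst; lra]. }
  apply is_derive_C_cauchy_riemann in Hl. destruct Hl as [HU HV].
  pose proof (differentiable_exp_mult cos (fun t => - sin t) (fst a) s t (derivable_pt_lim_cos t)) as G1.
  pose proof (differentiable_exp_mult sin cos (snd a) s t (derivable_pt_lim_sin t)) as G2.
  pose proof (differentiable_pt_lim_comp _ _ _ _ _ _ _ _ _ _ _ HU G1 G2) as KU.
  pose proof (differentiable_pt_lim_comp _ _ _ _ _ _ _ _ _ _ _ HV G1 G2) as KV.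
  cbv beta in KU, KV. do 3 eexists. split; [exact KV|].
  (* The Cauchy-Riemann equation [dV/dt = dU/ds], which is the closedness of [V ds + U dt]. *)
  replace (snd l * (exp s * - sin t) + fst l * (exp s * cos t))
    with (fst l * (exp s * cos t) + - snd l * (exp s * sin t)) by ring.
  exact KU. }
pose proof (goursat_closed_form V U s0 s1 0 (2 * PI) Hs ltac:(lra) Hd) as HG.
assert (HP : forall s, polar a s (2 * PI) = polar a s 0).
{ intros s; unfold polar. rewrite sin_2PI, cos_2PI, sin_0, cos_0. reflexivity. }
unfold rect_integral in HG.
(* The sides [t = 0] and [t = 2 PI] have the same image under [polar], so their contributions
   cancel. *)
rewrite (RInt_ext (V := R_CompleteNormedModule) _ (fun _ => 0)) in HG
  by (intros x _; unfold V; rewrite HP; apply Rminus_diag).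
rewrite RInt_const in HG.
assert (Hc : forall x y, s0 <= x <= s1 -> 0 <= y <= 2 * PI ->
  continuity_2d_pt V x y /\ continuity_2d_pt U x y).
{ intros x y Hx Hy. destruct (Hd x y Hx Hy) as (p & e & q & H1 & H2).
  split; apply differentiable_continuity_pt; [exists p, e|exists e, q]; assumption. }
destruct (ex_RInt_sections V U s0 s1 0 (2 * PI) Hc s0 s1 0 (2 * PI)) as [_ HE]; try lra.
rewrite (RInt_minus (V := R_CompleteNormedModule)) in HG by (apply HE; lra).
unfold minus, plus, opp, scal in HG; cbn -[RInt] in HG. unfold mult in HG; cbn -[RInt] in HG.
unfold U in HG. lra.
Qed.

Lemma ex_RInt_circle (f : C -> C) (a : C) (r s : R) :
  (forall z, 0 < Cmod (z - a) < r -> holo_at f z) -> exp s < r ->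
  ex_RInt (fun t => fst (f (polar a s t))) 0 (2 * PI).
Proof.
intros Hf Hs. pose proof PI_RGT_0 as HPI.
apply (ex_RInt_continuous (V := R_CompleteNormedModule)). intros t _.
destruct (Hf (polar a s t)) as [l Hl].
{ rewrite Cmod_polar. split; [apply exp_pos|assumption]. }
apply is_derive_C_cauchy_riemann in Hl. destruct Hl as [HU _].
pose proof (differentiable_exp_mult cos (fun t => - sin t) (fst a) s t (derivable_pt_lim_cos t)) as G1.
pose proof (differentiable_exp_mult sin cos (snd a) s t (derivable_pt_lim_sin t)) as G2.
pose proof (differentiable_pt_lim_comp _ _ _ _ _ _ _ _ _ _ _ HU G1 G2) as KU.
apply (continuity_2d_pt_section2 (fun u v => fst (f (polar a u v)))).
apply differentiable_continuity_pt. eexists; eexists; exact KU.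
Qed.

(** The circular means do not depend on the radius and tend to the value at the centre by
    continuity. The centre enters only through continuity, which is what makes an exceptional point
    possible in the maximum principle. *)
Lemma mean_value_property (f : C -> C) (a : C) (r s : R) :
  cont_at f a -> (forall z, 0 < Cmod (z - a) < r -> holo_at f z) -> exp s < r ->
  RInt (fun t => fst (f (polar a s t))) 0 (2 * PI) = 2 * PI * fst (f a).
Proof.
intros Hc Hf Hs. pose proof PI_RGT_0 as HPI.
apply Rminus_diag_uniq. apply NNPP. intros Hne. apply Rabs_pos_lt in Hne.
set (I := RInt _ _ _) in *. set (D := Rabs _) in Hne.
destruct (Hc (D / (4 * PI))) as [d [Hd Hc']].
{ apply Rdiv_lt_0_compat; lra. }
(* A radius at most [e^s] and below [d], on which [f] differs from [f a] by less than [D / (4 PI)];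
   integration over a length [2 PI] then gives [D <= D / 2]. *)
set (s0 := Rmin s (ln (d / 2))).
assert (Hs0 : exp s0 < d).
{ apply Rle_lt_trans with (exp (ln (d / 2))).
  - destruct (Req_dec s0 (ln (d / 2))) as [->|]; [lra|].
    left; apply exp_increasing. pose proof (Rmin_r s (ln (d / 2))). unfold s0 in *; lra.
  - rewrite exp_ln; lra. }
assert (E : I = RInt (fun t => fst (f (polar a s0 t))) 0 (2 * PI)).
{ symmetry. apply (circle_mean_const f a r); [assumption|apply Rmin_l|assumption]. }
assert (Hs0r : exp s0 < r).
{ apply Rle_lt_trans with (exp s); [|assumption].
  destruct (Req_dec s0 s) as [->|]; [lra|].
  left; apply exp_increasing. pose proof (Rmin_l s (ln (d / 2))). unfold s0 in *; lra. }
pose proof (ex_RInt_circle f a r s0 Hf Hs0r) as HE.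
assert (K : I - 2 * PI * fst (f a) = RInt (fun t => fst (f (polar a s0 t)) - fst (f a)) 0 (2 * PI)).
{ rewrite (RInt_minus (V := R_CompleteNormedModule) (fun t => fst (f (polar a s0 t))) (fun _ => fst (f a)));
    [|exact HE|apply ex_RInt_const].
  rewrite RInt_const, <- E.
  unfold minus, plus, opp, scal; cbn -[RInt]. unfold mult; cbn -[RInt]. unfold I; lra. }
assert (B : D <= (2 * PI - 0) * (D / (4 * PI))).
{ unfold D at 1. rewrite K. apply abs_RInt_le_const; [lra| |].
  - apply (ex_RInt_minus (V := R_NormedModule)); [exact HE|apply ex_RInt_const].
  - intros t _. left.
    eapply Rle_lt_trans; [|apply (Hc' (polar a s0 t)); rewrite Cmod_polar; assumption].
    apply (Rabs_fst_le (f (polar a s0 t) - f a)). }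
replace ((2 * PI - 0) * (D / (4 * PI))) with (D / 2) in B by (field; lra).
lra.
Qed.

(** * The maximum principle *)

Definition Cbounded (K : C -> Prop) : Prop := exists b, forall z, K z -> Cmod z <= b.
Definition Copen (G : C -> Prop) : Prop :=
  forall z, G z -> exists d, 0 < d /\ forall w, Cmod (w - z) < d -> G w.
Definition Ccompact (K : C -> Prop) : Prop :=
  Cbounded K /\ Copen (fun z => ~ K z).

(** Without a maximum, each point of a square around [K] has a neighbourhood in which [f] on [K]
    stays below its value at one point of [K]: at points of [K] by upper semicontinuity, elsewhere
    vacuously. [rect_induction] glues these into a single dominating point, which is a maximum after
    all. *)
Lemma compact_attains_max (K : C -> Prop) (f : C -> R) :
  Ccompact K -> (exists z, K z) ->
  (forall z, K z -> forall eps, 0 < eps -> exists d, 0 < d /\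
     forall w, K w -> Cmod (w - z) < d -> f w < f z + eps) ->
  exists p, K p /\ forall w, K w -> f w <= f p.
Proof.
intros [[b Hb] Hcl] [z0 Hz0] Hf. apply NNPP; intros Hno.
assert (Hup : forall p, K p -> exists q, K q /\ f p < f q).
{ intros p Hp. apply NNPP; intros Hn. apply Hno. exists p; split; [assumption|].
  intros w Hw. apply Rnot_lt_le; intros Hlt. apply Hn. exists w; tauto. }
assert (Hb0 : 0 <= b) by (pose proof (Hb z0 Hz0); pose proof (Cmod_ge_0 z0); lra).
set (Pr := fun x1 x2 y1 y2 => exists q, K q /\ forall w, K w ->
  x1 <= fst w <= x2 -> y1 <= snd w <= y2 -> f w <= f q).
assert (HPr : Pr (- b) b (- b) b).
{ apply rect_induction; try lra.
  - intros x1 x2 y1 y2 _ H1 _ _ H2 _ [q1 [K1 Q1]] [q2 [K2 Q2]] [q3 [K3 Q3]] [q4 [K4 Q4]].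
    assert (E : exists q, K q /\ f q1 <= f q /\ f q2 <= f q /\ f q3 <= f q /\ f q4 <= f q).
    { assert (Hmax : forall q q', K q -> K q' -> exists r, K r /\ f q <= f r /\ f q' <= f r).
      { intros q q' Hq Hq'. destruct (Rle_lt_dec (f q) (f q')); [exists q'|exists q]; repeat split; auto; lra. }
      destruct (Hmax q1 q2 K1 K2) as (q5 & K5 & L1 & L2).
      destruct (Hmax q3 q4 K3 K4) as (q6 & K6 & L3 & L4).
      destruct (Hmax q5 q6 K5 K6) as (q7 & K7 & L5 & L6).
      exists q7. repeat split; auto; lra. }
    destruct E as (q & Kq & L1 & L2 & L3 & L4).
    exists q; split; [assumption|]. intros w Hw Hx Hy.
    destruct (Rle_lt_dec (fst w) ((x1 + x2) / 2)) as [Hx'|Hx'];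
    destruct (Rle_lt_dec (snd w) ((y1 + y2) / 2)) as [Hy'|Hy'].
    + specialize (Q1 w Hw). lra.
    + specialize (Q3 w Hw). lra.
    + specialize (Q2 w Hw). lra.
    + specialize (Q4 w Hw). lra.
  - intros x y _ _.
    assert (Hnear : forall d x1 x2 y1 y2 w, x1 <= x <= x2 -> y1 <= y <= y2 -> x2 - x1 < d / 2 -> y2 - y1 < d / 2 ->
      x1 <= fst w <= x2 -> y1 <= snd w <= y2 -> Cmod (w - (x, y)) < d).
    { intros d x1 x2 y1 y2 w H1 H2 H3 H4 H5 H6.
      eapply Rle_lt_trans; [apply Cmod_le_abs2|].
      assert (Rabs (fst (w - (x, y))%C) < d / 2) by (simpl; apply Rabs_def1; lra).
      assert (Rabs (snd (w - (x, y))%C) < d / 2) by (simpl; apply Rabs_def1; lra). lra. }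
    destruct (classic (K (x, y))) as [HK|HK].
    + destruct (Hup _ HK) as [q [Kq Hq]].
      destruct (Hf _ HK (f q - f (x, y)) ltac:(lra)) as [d [Hd Hd']].
      exists (d / 2); split; [lra|]. intros x1 x2 y1 y2 _ H1 _ _ H2 _ H3 H4.
      exists q; split; [assumption|]. intros w Kw Hwx Hwy.
      specialize (Hd' w Kw (Hnear _ _ _ _ _ _ H1 H2 H3 H4 Hwx Hwy)). lra.
    + destruct (Hcl _ HK) as [d [Hd Hd']].
      exists (d / 2); split; [lra|]. intros x1 x2 y1 y2 _ H1 _ _ H2 _ H3 H4.
      exists z0; split; [assumption|]. intros w Kw Hwx Hwy.
      exfalso. apply (Hd' w (Hnear _ _ _ _ _ _ H1 H2 H3 H4 Hwx Hwy) Kw). }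
destruct HPr as [q [Kq Hq]]. apply Hno. exists q; split; [assumption|].
intros w Hw. pose proof (Hb w Hw).
apply Hq; [assumption| |]; apply Rabs_le_between.
- eapply Rle_trans; [apply Rabs_fst_le|assumption].
- eapply Rle_trans; [apply Rabs_snd_le|assumption].
Qed.

Lemma RInt_trig (a b c : R) :
  is_RInt (fun t => a + (b * cos t + c * sin t)) 0 (2 * PI) (2 * PI * a).
Proof.
set (F := fun t => a * t + (b * sin t - c * cos t)).
replace (2 * PI * a) with (minus (F (2 * PI)) (F 0)).
2:{ unfold F, minus, plus, opp; simpl. rewrite sin_2PI, cos_2PI, sin_0, cos_0. ring. }
apply (is_RInt_derive (V := R_CompleteNormedModule)).
- intros x _. unfold F. auto_derive; [trivial|ring].
- intros x _. apply (ex_derive_continuous (V := R_NormedModule)). auto_derive; trivial.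
Qed.

Lemma Cmod_polar_sqr (a : C) (s t : R) :
  Cmod (polar a s t) ^ 2 =
  Cmod a ^ 2 + exp s ^ 2 + (2 * exp s * fst a * cos t + 2 * exp s * snd a * sin t).
Proof.
rewrite !Cmod_sqr. unfold polar; simpl fst; simpl snd.
pose proof (sin2_cos2 t) as E; unfold Rsqr in E.
replace (exp s ^ 2) with (exp s ^ 2 * (sin t * sin t + cos t * cos t)) by (rewrite E; ring).
ring.
Qed.

(* The perturbation [eps |z|^2] turns the mean value property into a strict
   sub-mean-value property, which rules out interior maxima. *)
Lemma no_interior_max (f : C -> C) (a : C) (r eps : R) :
  0 < r -> 0 < eps -> cont_at f a ->
  (forall z, 0 < Cmod (z - a) < r -> holo_at f z) ->
  ~ (forall w, Cmod (w - a) < r ->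
       fst (f w) + eps * Cmod w ^ 2 <= fst (f a) + eps * Cmod a ^ 2).
Proof.
intros Hr Heps Hc Hf Hmax. pose proof PI_RGT_0 as HPI.
set (s := ln (r / 2)).
assert (Hs : exp s < r) by (unfold s; rewrite exp_ln; lra).
pose proof (mean_value_property f a r s Hc Hf Hs) as MV.
pose proof (RInt_trig (fst (f a) - eps * exp s ^ 2)
  (- (2 * eps * exp s * fst a)) (- (2 * eps * exp s * snd a))) as HT.
assert (HI : RInt (fun t => fst (f (polar a s t))) 0 (2 * PI) <= 2 * PI * (fst (f a) - eps * exp s ^ 2)).
{ rewrite <- (is_RInt_unique (V := R_CompleteNormedModule) _ _ _ _ HT).
  apply RInt_le; [lra| |eexists; exact HT|].
  - apply (ex_RInt_circle f a r); assumption.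
  - intros t _. specialize (Hmax (polar a s t)). rewrite Cmod_polar, Cmod_polar_sqr in Hmax.
    specialize (Hmax Hs). nra. }
rewrite MV in HI.
assert (0 < exp s ^ 2) by (apply pow_lt, exp_pos).
assert (0 < eps * exp s ^ 2) by (apply Rmult_lt_0_compat; assumption).
nra.
Qed.

(** * Continuity relative to a set, and the maximum principle itself *)

Lemma cont_withinE (K : C -> Prop) (f : C -> C) (z : C) :
  cont_within K f z -> forall eps, 0 < eps -> exists delta, 0 < delta /\
    forall w, K w -> Cmod (w - z) < delta -> Cmod (f w - f z) < eps.
Proof. exact (fun H => H). Qed.

Lemma cont_within_cont_at (K : C -> Prop) (f : C -> C) (z : C) (d : R) :
  0 < d -> (forall w, Cmod (w - z) < d -> K w) -> cont_within K f z -> cont_at f z.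
Proof.
intros Hd HK Hc eps Heps. destruct (Hc eps Heps) as [d' [Hd' H]].
exists (Rmin d d'); split; [apply Rmin_pos; assumption|].
intros w Hw. pose proof (Rmin_l d d'). pose proof (Rmin_r d d').
apply H; [apply HK; lra|].
change (Cmod (w - z) < d'). lra.
Qed.

Lemma cont_at_within (K : C -> Prop) (f : C -> C) (z : C) :
  cont_at f z -> cont_within K f z.
Proof.
intros H eps Heps. destruct (H eps Heps) as [d [Hd H']].
exists d; split; [assumption|]. intros w _ Hw. apply H', Hw.
Qed.

Lemma cont_within_mult (K : C -> Prop) (f g : C -> C) (z : C) :
  cont_within K f z -> cont_within K g z -> cont_within K (fun w => f w * g w)%C z.
Proof.
intros Hf Hg eps Heps.
set (m := Cmod (f z)). set (n := Cmod (g z)).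
assert (Hm : 0 <= m) by apply Cmod_ge_0. assert (Hn : 0 <= n) by apply Cmod_ge_0.
set (e := Rmin 1 (eps / (m + n + 2))).
assert (Hq : 0 < eps / (m + n + 2)) by (apply Rdiv_lt_0_compat; lra).
assert (He : 0 < e) by (apply Rmin_pos; lra).
assert (He1 : e <= 1) by apply Rmin_l.
assert (He2 : e * (m + n + 2) <= eps).
{ apply Rle_trans with (eps / (m + n + 2) * (m + n + 2)).
  - apply Rmult_le_compat_r; [lra|apply Rmin_r].
  - right; field; lra. }
destruct (Hf e He) as [d1 [Hd1 H1]]. destruct (Hg e He) as [d2 [Hd2 H2]].
exists (Rmin d1 d2); split; [apply Rmin_pos; assumption|].
intros w Kw Hw. pose proof (Rmin_l d1 d2). pose proof (Rmin_r d1 d2).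
specialize (H1 w Kw ltac:(lra)). specialize (H2 w Kw ltac:(lra)).
change (Cmod (f w - f z) < e) in H1. change (Cmod (g w - g z) < e) in H2.
change (Cmod (f w * g w - f z * g z) < eps).
replace (f w * g w - f z * g z)%C
  with ((f w - f z) * (g w - g z) + (f w - f z) * g z + f z * (g w - g z))%C by ring.
eapply Rle_lt_trans; [apply Cmod_triangle|].
eapply Rle_lt_trans; [apply Rplus_le_compat_r, Cmod_triangle|].
rewrite !Cmod_mult. fold m n.
pose proof (Cmod_ge_0 (f w - f z)). pose proof (Cmod_ge_0 (g w - g z)). nra.
Qed.

Lemma cont_at_const (c z : C) : cont_at (fun _ => c) z.
Proof. apply holo_at_cont_at, holo_at_const. Qed.

Lemma cont_within_pow (K : C -> Prop) (f : C -> C) (z : C) (n : nat) :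
  cont_within K f z -> cont_within K (fun w => Cpow (f w) n) z.
Proof.
intros H. induction n as [|n IH]; simpl.
- apply cont_at_within, cont_at_const.
- apply (cont_within_mult K f); assumption.
Qed.

Lemma cont_within_minus (K : C -> Prop) (f g : C -> C) (z : C) :
  cont_within K f z -> cont_within K g z -> cont_within K (fun w => f w - g w)%C z.
Proof.
intros Hf Hg eps Heps.
destruct (Hf (eps / 2) ltac:(lra)) as [d1 [Hd1 H1]]. destruct (Hg (eps / 2) ltac:(lra)) as [d2 [Hd2 H2]].
exists (Rmin d1 d2); split; [apply Rmin_pos; assumption|].
intros w Kw Hw. pose proof (Rmin_l d1 d2). pose proof (Rmin_r d1 d2).
specialize (H1 w Kw ltac:(lra)). specialize (H2 w Kw ltac:(lra)).
change (Cmod (f w - f z) < eps / 2) in H1. change (Cmod (g w - g z) < eps / 2) in H2.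
change (Cmod ((f w - g w) - (f z - g z)) < eps).
replace ((f w - g w) - (f z - g z))%C with ((f w - f z) + - (g w - g z))%C by ring.
eapply Rle_lt_trans; [apply Cmod_triangle|]. rewrite Cmod_opp. lra.
Qed.

Lemma cont_within_subset (K K' : C -> Prop) (f : C -> C) (z : C) :
  (forall w, K' w -> K w) -> cont_within K f z -> cont_within K' f z.
Proof.
intros HK H eps Heps. destruct (H eps Heps) as [d [Hd H']].
exists d; split; [assumption|]. intros w Kw. apply H', HK, Kw.
Qed.

(** A unimodular factor [c] makes the real part of [c f] equal to [|f|] at [z], and a real part
    never exceeds the modulus. If [|f z| > M], this real part plus a small multiple of [|w|^2] has
    its maximum over [K] in [G], which [no_interior_max] excludes. *)
Lemma maximum_principle (K G : C -> Prop) (f : C -> C) (p : C) (M : R) :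
  Ccompact K -> Copen G -> (forall z, G z -> K z) -> 0 <= M ->
  (forall z, K z -> cont_within K f z) ->
  (forall z, G z -> z <> p -> holo_at f z) ->
  (forall z, K z -> ~ G z -> Cmod (f z) <= M) ->
  forall z, K z -> Cmod (f z) <= M.
Proof.
intros HK HG HGK HM Hc Hf Hbd z Hz. apply Rnot_lt_le; intros Hlt.
set (v := Cmod (f z)) in *.
set (c := (Cconj (f z) / v)%C).
assert (Hv : v <> 0) by lra.
assert (HvC : RtoC v <> 0) by (intros E; apply Hv; injection E; trivial).
assert (Hc1 : Cmod c = 1).
{ unfold c. rewrite Cmod_div by assumption. rewrite Cmod_conj, Cmod_R, Rabs_pos_eq by lra.
  unfold v; field; assumption. }
assert (Hcz : (c * f z)%C = v).
{ unfold c. replace (Cconj (f z) / v * f z)%C with ((f z * Cconj (f z)) / v)%C by (field; assumption).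
  rewrite <- Cmod2_conj. fold v. rewrite <- RtoC_div by assumption. f_equal. field; assumption. }
set (g := fun w => (c * f w)%C).
assert (Hg : forall w, fst (g w) <= Cmod (f w)).
{ intros w. eapply Rle_trans; [apply Rle_abs|]. eapply Rle_trans; [apply Rabs_fst_le|].
  unfold g. rewrite Cmod_mult, Hc1. lra. }
assert (Hgc : forall w, K w -> cont_within K g w).
{ intros w Kw. apply (cont_within_mult K (fun _ => c)); [apply cont_at_within, cont_at_const|auto]. }
assert (Hgz : fst (g z) = v) by (unfold g; rewrite Hcz; reflexivity).
assert (Hgh : forall w, holo_at f w -> holo_at g w).
{ intros w. apply (holo_at_mult (fun _ => c)), holo_at_const. }
clearbody g.
destruct HK as [[b Hb] Hcl].
assert (Hb2 : forall w, K w -> Cmod w ^ 2 <= b ^ 2).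
{ intros w Kw. apply pow_incr. split; [apply Cmod_ge_0|auto]. }
pose proof (pow2_ge_0 b) as Hb0.
(* The perturbation stays below the gap [v - M] on [K]; the summand 1 keeps the denominator
   positive. *)
set (eps := (v - M) / (2 * (b ^ 2 + 1))).
assert (Heps : 0 < eps) by (apply Rdiv_lt_0_compat; lra).
assert (HepsB : eps * b ^ 2 < v - M).
{ replace (v - M) with (eps * (2 * (b ^ 2 + 1))) by (unfold eps; field; lra). nra. }
destruct (compact_attains_max K (fun w => fst (g w) + eps * Cmod w ^ 2)) as [a [Ka Ha]].
- split; [exists b|]; assumption.
- exists z; assumption.
- intros w Kw e He.
  destruct (cont_withinE _ _ _ (Hgc w Kw) (e / 2) ltac:(lra)) as [d1 [Hd1 H1]].
  set (d2 := Rmin 1 (e / 2 / (eps * (2 * Cmod w + 1)))).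
  pose proof (Cmod_ge_0 w) as Hw0.
  assert (Hpos : 0 < eps * (2 * Cmod w + 1)) by (apply Rmult_lt_0_compat; lra).
  assert (Hd2 : 0 < d2) by (apply Rmin_pos; [lra|apply Rdiv_lt_0_compat; lra]).
  exists (Rmin d1 d2); split; [apply Rmin_pos; assumption|].
  intros w' Kw' Hw'. pose proof (Rmin_l d1 d2). pose proof (Rmin_r d1 d2).
  specialize (H1 w' Kw' ltac:(lra)).
  pose proof (Rle_lt_trans _ _ _ (Rabs_fst_le _) H1) as H2. apply Rabs_def2 in H2.
  pose proof (Cmod_triangle w (w' - w)) as T. replace (w + (w' - w))%C with w' in T by ring.
  pose proof (Cmod_ge_0 w') as Hw0'. pose proof (Cmod_ge_0 (w' - w)) as Hx0.
  assert (Hx : Cmod (w' - w) < d2) by lra. set (x := Cmod (w' - w)) in *.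
  assert (x <= 1) by (pose proof (Rmin_l 1 (e / 2 / (eps * (2 * Cmod w + 1)))); unfold d2 in *; lra).
  assert (x * (eps * (2 * Cmod w + 1)) < e / 2).
  { apply Rlt_le_trans with (e / 2 / (eps * (2 * Cmod w + 1)) * (eps * (2 * Cmod w + 1))).
    - apply Rmult_lt_compat_r; [assumption|].
      pose proof (Rmin_r 1 (e / 2 / (eps * (2 * Cmod w + 1)))); unfold d2 in *; lra.
    - right; field; lra. }
  assert (Cmod w' ^ 2 <= (Cmod w + x) ^ 2) by (apply pow_incr; lra).
  assert ((Cmod w + x) ^ 2 <= Cmod w ^ 2 + x * (2 * Cmod w + 1)) by nra.
  assert (eps * Cmod w' ^ 2 <= eps * (Cmod w ^ 2 + x * (2 * Cmod w + 1))) by (apply Rmult_le_compat_l; lra).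
  change (fst (g w' - g w)%C) with (fst (g w') - fst (g w)) in H2. lra.
- destruct (classic (G a)) as [Ga|nGa].
  + destruct (HG a Ga) as [d [Hd HdG]].
    (* The radius is shrunk until [p] is the centre [a] or lies outside the open disc. *)
    assert (E : exists r, 0 < r /\ r <= d /\ forall w, 0 < Cmod (w - a) < r -> w <> p).
    { destruct (classic (p = a)) as [->|Hpa].
      - exists d; repeat split; try lra. intros w [Hw _] ->.
        replace (a - a)%C with (RtoC 0) in Hw by ring. rewrite Cmod_0 in Hw. lra.
      - assert (0 < Cmod (p - a)).
        { apply Cmod_gt_0. intros E. apply Hpa. replace p with (p - a + a)%C by ring. rewrite E. ring. }
        exists (Rmin d (Cmod (p - a))). repeat split; [apply Rmin_pos; assumption|apply Rmin_l|].
        intros w [_ Hw] ->. pose proof (Rmin_r d (Cmod (p - a))). lra. }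
    destruct E as (r & Hr & Hrd & Hrp).
    apply (no_interior_max g a r eps Hr Heps).
    * apply (cont_within_cont_at K g a d); auto.
    * intros w Hw. apply Hgh, Hf; [apply HdG; lra|]. apply Hrp, Hw.
    * intros w Hw. apply Ha, HGK, HdG. lra.
  + pose proof (Hbd a Ka nGa). pose proof (Ha z Hz) as H1.
    pose proof (Hg a). pose proof (Hb2 a Ka).
    rewrite Hgz in H1.
    assert (eps * Cmod a ^ 2 <= eps * b ^ 2) by (apply Rmult_le_compat_l; lra).
    assert (0 <= eps * Cmod z ^ 2) by (apply Rmult_le_pos; [lra|apply pow2_ge_0]).
    lra.
Qed.

(** * Two-constants estimates *)

(** The maximum principle for [h g^n]: on one part of the boundary [|g| <= 1] keeps the bound [M],
    on the other the smallness of [h] works against [L^n]. Once [n] is fixed, [eps] can be chosen to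
    win. *)
Lemma two_constants (K G : C -> Prop) (h g : C -> C) (M eps L : R) :
  Ccompact K -> Copen G -> (forall z, G z -> K z) ->
  0 <= M -> 0 <= eps ->
  (forall z, K z -> cont_within K h z) -> (forall z, K z -> cont_within K g z) ->
  (forall z, G z -> holo_at h z) -> (forall z, G z -> holo_at g z) ->
  (forall z, K z -> Cmod (g z) <= L) ->
  (forall z, K z -> ~ G z -> (Cmod (h z) <= M /\ Cmod (g z) <= 1) \/ Cmod (h z) <= eps) ->
  forall n z, K z -> Cmod (h z) * Cmod (g z) ^ n <= M + eps * L ^ n.
Proof.
intros HK HG HGK HM He ch cg hh hg HL Hbd n z Hz.
assert (HL0 : 0 <= L) by (pose proof (HL z Hz); pose proof (Cmod_ge_0 (g z)); lra).
assert (HLn : 0 <= eps * L ^ n) by (apply Rmult_le_pos; [assumption|apply pow_le; assumption]).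
rewrite <- Cmod_pow, <- Cmod_mult.
(* [0] is a default value for the exceptional point, since the product is holomorphic on all of
   [G]. *)
apply (maximum_principle K G (fun w => h w * Cpow (g w) n)%C 0 (M + eps * L ^ n)); auto.
- lra.
- intros w Kw. apply cont_within_mult; [auto|]. apply cont_within_pow; auto.
- intros w Gw _. apply holo_at_mult; [auto|]. apply holo_at_pow; auto.
- intros w Kw nGw. rewrite Cmod_mult, Cmod_pow.
  pose proof (Cmod_ge_0 (g w)). pose proof (Cmod_ge_0 (h w)).
  assert (0 <= Cmod (g w) ^ n) by (apply pow_le; assumption).
  destruct (Hbd w Kw nGw) as [[B1 B2]|B1].
  + assert (Cmod (g w) ^ n <= 1) by (rewrite <- (pow1 n); apply pow_incr; lra). nra.
  + assert (Cmod (g w) ^ n <= L ^ n) by (apply pow_incr; auto). nra.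
Qed.

(** The case [eps = 0]: [|h| |g|^n <= M] for every [n], which at a point with [|g| > 1] leaves only
    [h = 0]. *)
Lemma two_constants_zero (K G : C -> Prop) (h g : C -> C) (M L : R) :
  Ccompact K -> Copen G -> (forall z, G z -> K z) -> 0 <= M ->
  (forall z, K z -> cont_within K h z) -> (forall z, K z -> cont_within K g z) ->
  (forall z, G z -> holo_at h z) -> (forall z, G z -> holo_at g z) ->
  (forall z, K z -> Cmod (g z) <= L) ->
  (forall z, K z -> ~ G z -> (Cmod (h z) <= M /\ Cmod (g z) <= 1) \/ h z = 0) ->
  forall z, K z -> 1 < Cmod (g z) -> h z = 0.
Proof.
intros HK HG HGK HM ch cg hh hg HL Hbd z Hz Hgz.
apply Cmod_eq_0. apply NNPP; intros Hne.
pose proof (Cmod_ge_0 (h z)).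
assert (Hh : 0 < Cmod (h z)) by lra.
destruct (Pow_x_infinity (Cmod (g z)) ltac:(rewrite Rabs_pos_eq; [lra|apply Cmod_ge_0]) (M / Cmod (h z) + 1)) as [n Hn].
specialize (Hn n (le_n n)).
rewrite Rabs_pos_eq in Hn by (apply pow_le, Cmod_ge_0).
assert (B : Cmod (h z) * Cmod (g z) ^ n <= M + 0 * L ^ n).
{ apply (two_constants K G); auto; [lra|].
  intros w Kw nGw. destruct (Hbd w Kw nGw) as [|E]; [left; assumption|right].
  rewrite E, Cmod_0. lra. }
assert (Cmod (h z) * (M / Cmod (h z) + 1) <= Cmod (h z) * Cmod (g z) ^ n) by (apply Rmult_le_compat_l; lra).
replace (Cmod (h z) * (M / Cmod (h z) + 1)) with (M + Cmod (h z)) in H0 by (field; lra).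
lra.
Qed.

(** * Uniform limits of holomorphic functions *)

Definition Clim (x : nat -> C) (l : C) : Prop :=
  forall eps, 0 < eps -> exists N, forall n, (N <= n)%nat -> Cmod (x n - l) <= eps.

Lemma Ccauchy_cv (x : nat -> C) :
  (forall eps, 0 < eps -> exists N, forall i j, (N <= i)%nat -> (N <= j)%nat ->
     Cmod (x i - x j) <= eps) ->
  exists l, Clim x l.
Proof.
intros H.
assert (Hre : Cauchy_crit (fun n => fst (x n))).
{ intros eps Heps. destruct (H (eps / 2) ltac:(lra)) as [N HN]. exists N. intros n m Hn Hm.
  eapply Rle_lt_trans; [apply (Rabs_fst_le (x n - x m))|].
  specialize (HN n m Hn Hm). lra. }
assert (Him : Cauchy_crit (fun n => snd (x n))).
{ intros eps Heps. destruct (H (eps / 2) ltac:(lra)) as [N HN]. exists N. intros n m Hn Hm.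
  eapply Rle_lt_trans; [apply (Rabs_snd_le (x n - x m))|].
  specialize (HN n m Hn Hm). lra. }
destruct (Rcomplete.R_complete _ Hre) as [a Ha]. destruct (Rcomplete.R_complete _ Him) as [b Hb].
exists (a, b). intros eps Heps.
destruct (Ha (eps / 2) ltac:(lra)) as [N1 H1]. destruct (Hb (eps / 2) ltac:(lra)) as [N2 H2].
exists (max N1 N2). intros n Hn.
eapply Rle_trans; [apply Cmod_le_abs2|].
specialize (H1 n ltac:(lia)). specialize (H2 n ltac:(lia)). unfold Rdist in *.
change (Rabs (fst (x n) - a) + Rabs (snd (x n) - b) <= eps). lra.
Qed.

Lemma Clim_bound (x : nat -> C) (l y : C) (eta : R) (N : nat) :
  Clim x l -> (forall n, (N <= n)%nat -> Cmod (x n - y) <= eta) -> Cmod (l - y) <= eta.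
Proof.
intros Hl H. apply Rnot_lt_le; intros Hlt.
destruct (Hl ((Cmod (l - y) - eta) / 2) ltac:(lra)) as [N' H'].
specialize (H (max N N') ltac:(lia)). specialize (H' (max N N') ltac:(lia)).
pose proof (Cmod_triangle (x (max N N') - y) (- (x (max N N') - l))) as T.
rewrite Cmod_opp in T.
replace (x (max N N') - y + - (x (max N N') - l))%C with (l - y)%C in T by ring. lra.
Qed.

Lemma closed_disc_compact (c : C) (r : R) : Ccompact (fun z => Cmod (z - c) <= r).
Proof.
split.
- exists (r + Cmod c). intros z Hz. pose proof (Cmod_triangle (z - c) c) as T.
  replace (z - c + c)%C with z in T by ring. lra.
- intros z Hz. exists (Cmod (z - c) - r). split; [lra|]. intros w Hw Hwc.
  pose proof (Cmod_triangle (w - c) (- (w - z))) as T. rewrite Cmod_opp in T.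
  replace (w - c + - (w - z))%C with (z - c)%C in T by ring. lra.
Qed.

Lemma open_disc_open (c : C) (r : R) : Copen (fun z => Cmod (z - c) < r).
Proof.
intros z Hz. exists (r - Cmod (z - c)). split; [lra|]. intros w Hw.
pose proof (Cmod_triangle (w - z) (z - c)) as T.
replace (w - z + (z - c))%C with (w - c)%C in T by ring. lra.
Qed.

Definition slope (f : C -> C) (a l z : C) : C :=
  if excluded_middle_informative (z = a) then l else ((f z - f a) / (z - a))%C.

Lemma slope_mult (f : C -> C) (a l z : C) :
  (slope f a l z * (z - a) = f z - f a)%C.
Proof.
unfold slope. destruct (excluded_middle_informative _) as [->|Hne]; [ring|].
field. intros E. apply Hne. replace z with (z - a + a)%C by ring. rewrite E. ring.
Qed.

Lemma slope_cont_at (f : C -> C) (a l : C) :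
  is_derive (K := C_AbsRing) (V := AbsRing_NormedModule C_AbsRing) f a l ->
  cont_at (slope f a l) a.
Proof.
intros H eps Heps.
destruct (proj1 (is_derive_C_iff f a l) H (eps / 2) ltac:(lra)) as [d [Hd H']].
exists d; split; [assumption|]. intros w Hw.
assert (Ea : slope f a l a = l).
{ unfold slope. destruct (excluded_middle_informative _); [reflexivity|tauto]. }
rewrite Ea.
destruct (classic (w = a)) as [->|Hwa].
- rewrite Ea. replace (l - l)%C with (RtoC 0) by ring. rewrite Cmod_0. assumption.
- assert (Hx : 0 < Cmod (w - a)).
  { apply Cmod_gt_0. intros E. apply Hwa. replace w with (w - a + a)%C by ring. rewrite E. ring. }
  specialize (H' w Hw). rewrite <- (slope_mult f a l w) in H'.
  replace (slope f a l w * (w - a) - l * (w - a))%C with ((slope f a l w - l) * (w - a))%C in H' by ring.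
  rewrite Cmod_mult in H'. apply Rmult_le_reg_r in H'; [|assumption]. lra.
Qed.

Lemma slope_holo_at (f : C -> C) (a l z : C) :
  z <> a -> holo_at f z -> holo_at (slope f a l) z.
Proof.
intros Hz Hf.
assert (Hx : 0 < Cmod (z - a)).
{ apply Cmod_gt_0. intros E. apply Hz. replace z with (z - a + a)%C by ring. rewrite E. ring. }
apply (holo_at_ext_loc (fun w => (f w - f a) * / (w - a))%C _ _ _ Hx).
- intros w Hw. unfold slope. destruct (excluded_middle_informative _) as [->|Hne]; [|reflexivity].
  replace (a - z)%C with (- (z - a))%C in Hw by ring. rewrite Cmod_opp in Hw. lra.
- apply holo_at_mult; [|apply holo_at_inv; assumption].
  apply holo_at_minus; [assumption|apply holo_at_const].
Qed.

(* Weierstrass's theorem: the slopes of the [f j] at [a] are uniformly Cauchy on a disc around [a],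
   by the maximum principle with exceptional point [a]. *)
Lemma uniform_limit_holo (f : nat -> C -> C) (F : C -> C) (a : C) (r : R) :
  0 < r ->
  (forall j z, Cmod (z - a) < r -> holo_at (f j) z) ->
  (forall eps, 0 < eps -> exists N, forall j z, (N <= j)%nat -> Cmod (z - a) < r ->
     Cmod (f j z - F z) <= eps) ->
  holo_at F a.
Proof.
intros Hr Hf Hu.
assert (Haa : Cmod (a - a) = 0) by (replace (a - a)%C with (RtoC 0) by ring; apply Cmod_0).
assert (Hl : forall j, exists l, is_derive (K := C_AbsRing) (V := AbsRing_NormedModule C_AbsRing) (f j) a l).
{ intros j. apply (Hf j a). lra. }
apply functional_choice in Hl. destruct Hl as [l Hl].
set (q := fun j => slope (f j) a (l j)).
set (rho := r / 2). assert (Hrho : 0 < rho) by (unfold rho; lra).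
assert (Hq : forall eta, 0 < eta -> exists N, forall i j z, (N <= i)%nat -> (N <= j)%nat ->
  Cmod (z - a) <= rho -> Cmod (q i z - q j z) <= eta).
{ intros eta Heta.
  (* On the circle [|z - a| = rho] the difference of two slopes times [z - a] is a sum of four
     errors of uniform approximation, each at most [eta * rho / 4]. *)
  destruct (Hu (eta * rho / 4)) as [N HN]; [apply Rdiv_lt_0_compat; [apply Rmult_lt_0_compat|]; lra|].
  exists N. intros i j z0 Hi Hj Hz0.
  apply (maximum_principle (fun z => Cmod (z - a) <= rho) (fun z => Cmod (z - a) < rho)
    (fun z => q i z - q j z)%C a eta); try assumption; try lra.
  - apply closed_disc_compact.
  - apply open_disc_open.
  - intros z Hz; lra.
  - intros z Hz. apply cont_at_within.
    destruct (classic (z = a)) as [->|Hza].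
    + apply (cont_within_cont_at (fun _ => True) _ a 1); [lra|trivial|].
      apply cont_within_minus; apply cont_at_within, slope_cont_at, Hl.
    + apply holo_at_cont_at, holo_at_minus; apply slope_holo_at; trivial; apply Hf; unfold rho in *; lra.
  - intros z Hz Hza. apply holo_at_minus; apply slope_holo_at; trivial; apply Hf; unfold rho in *; lra.
  - intros z Hz Hz'. assert (E : Cmod (z - a) = rho) by lra.
    apply Rmult_le_reg_r with rho; [assumption|]. rewrite <- E at 1. rewrite <- Cmod_mult.
    replace ((q i z - q j z) * (z - a))%C
      with ((f i z - F z) + - (f j z - F z) + - (f i a - F a) + (f j a - F a))%C.
    2:{ transitivity (q i z * (z - a) - q j z * (z - a))%C; [|ring].
        unfold q; rewrite !slope_mult. ring. }
    assert (Hzr : Cmod (z - a) < r) by (unfold rho in *; lra).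
    pose proof (HN i z Hi Hzr). pose proof (HN j z Hj Hzr).
    pose proof (HN i a Hi ltac:(lra)). pose proof (HN j a Hj ltac:(lra)).
    eapply Rle_trans; [apply Cmod_triangle|].
    eapply Rle_trans; [apply Rplus_le_compat_r, Cmod_triangle|].
    eapply Rle_trans; [apply Rplus_le_compat_r, Rplus_le_compat_r, Cmod_triangle|].
    rewrite !Cmod_opp. lra. }
assert (Hqa : forall j, q j a = l j).
{ intros j. unfold q, slope. destruct (excluded_middle_informative _); [reflexivity|tauto]. }
destruct (Ccauchy_cv l) as [L HL].
{ intros eps Heps. destruct (Hq eps Heps) as [N HN]. exists N. intros i j Hi Hj.
  rewrite <- !Hqa. apply HN; trivial. lra. }
exists L. apply is_derive_C_iff. intros eps Heps.
destruct (Hq (eps / 3) ltac:(lra)) as [N1 HN1].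
destruct (HL (eps / 3) ltac:(lra)) as [N2 HN2].
set (j := max N1 N2).
destruct (slope_cont_at (f j) a (l j) (Hl j) (eps / 3) ltac:(lra)) as [d [Hd Hcd]].
exists (Rmin d rho); split; [apply Rmin_pos; assumption|].
intros w Hw. pose proof (Rmin_l d rho) as Hm1. pose proof (Rmin_r d rho) as Hm2.
assert (Hwr : Cmod (w - a) < r) by (unfold rho in *; lra).
(* The bound between [q i] and [q j] passes to the limit in [i], where increments of [f i] become
   increments of [F]. *)
assert (E1 : Cmod ((F w - F a) - q j w * (w - a)) <= eps / 3 * Cmod (w - a)).
{ apply (Clim_bound (fun i => f i w - f i a)%C _ _ _ N1).
  - intros e He. destruct (Hu (e / 2) ltac:(lra)) as [N HN]. exists N. intros n Hn.
    replace (f n w - f n a - (F w - F a))%C with ((f n w - F w) + - (f n a - F a))%C by ring.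
    eapply Rle_trans; [apply Cmod_triangle|]. rewrite Cmod_opp.
    pose proof (HN n w Hn Hwr). pose proof (HN n a Hn ltac:(lra)). lra.
  - intros n Hn. rewrite <- (slope_mult (f n) a (l n) w).
    change (slope (f n) a (l n) w) with (q n w).
    replace (q n w * (w - a) - q j w * (w - a))%C with ((q n w - q j w) * (w - a))%C by ring.
    rewrite Cmod_mult. apply Rmult_le_compat_r; [apply Cmod_ge_0|].
    apply HN1; [assumption|unfold j; lia|lra]. }
replace (F w - F a - L * (w - a))%C
  with ((F w - F a - q j w * (w - a)) + ((q j w - q j a) + (l j - L)) * (w - a))%C
  by (rewrite Hqa; ring).
eapply Rle_trans; [apply Cmod_triangle|]. rewrite Cmod_mult.
assert (E2 : Cmod (q j w - q j a + (l j - L)) <= eps / 3 + eps / 3).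
{ eapply Rle_trans; [apply Cmod_triangle|]. apply Rplus_le_compat.
  - left. apply Hcd. lra.
  - apply HN2. unfold j; lia. }
pose proof (Cmod_ge_0 (w - a)). nra.
Qed.

(** * Extendable functions *)

Lemma Cmod_sub_diag (z : C) : Cmod (z - z) = 0.
Proof. replace (z - z)%C with (RtoC 0) by ring. apply Cmod_0. Qed.

Lemma Cmod_sub_sym (z w : C) : Cmod (z - w) = Cmod (w - z).
Proof. rewrite <- Cmod_opp. f_equal. ring. Qed.

Lemma Cmod_sub_triangle (z w v : C) : Cmod (z - v) <= Cmod (z - w) + Cmod (w - v).
Proof.
replace (z - v)%C with ((z - w) + (w - v))%C by ring. apply Cmod_triangle.
Qed.

(** * The circle and its parametrization by the angle *)

Lemma onT_expi (t : R) : onT (expi t).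
Proof.
unfold onT, expi, Defs.Cmod; simpl fst; simpl snd.
pose proof (sin2_cos2 t) as E; unfold Rsqr in E.
replace (cos t ^ 2 + sin t ^ 2) with 1 by lra. apply sqrt_1.
Qed.

Lemma onT_sqr (z : C) : onT z -> fst z ^ 2 + snd z ^ 2 = 1.
Proof. intros H. rewrite <- Cmod_sqr. change (Cmod z = 1) in H. rewrite H. ring. Qed.

(** After division by [expi t0] the point lies on the right half of the circle, where the angle is
    the arcsine of the imaginary part. *)
Lemma expi_asin (t0 : R) (w : C) :
  onT w -> 0 <= fst (w * Cconj (expi t0))%C ->
  w = expi (t0 + asin (snd (w * Cconj (expi t0))%C)).
Proof.
intros Hw Hc.
assert (Hq : onT (w * Cconj (expi t0))%C).
{ change (Cmod (w * Cconj (expi t0)) = 1). rewrite Cmod_mult, Cmod_conj.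
  change (Cmod w = 1) in Hw. pose proof (onT_expi t0) as H. change (Cmod (expi t0) = 1) in H.
  rewrite Hw, H. ring. }
apply onT_sqr in Hq.
set (q := (w * Cconj (expi t0))%C) in *.
assert (Hs : -1 <= snd q <= 1) by nra.
assert (Hcos : cos (asin (snd q)) = fst q).
{ rewrite cos_asin by assumption. unfold Rsqr.
  replace (1 - snd q * snd q) with (fst q * fst q) by lra. apply sqrt_square; assumption. }
unfold expi. rewrite cos_plus, sin_plus, Hcos, sin_asin by assumption.
unfold q. pose proof (sin2_cos2 t0) as E; unfold Rsqr in E.
destruct w as [x y]; simpl. f_equal.
- transitivity (x * (sin t0 * sin t0 + cos t0 * cos t0)); [rewrite E|]; ring.
- transitivity (y * (sin t0 * sin t0 + cos t0 * cos t0)); [rewrite E|]; ring.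
Qed.

(** The charts of [expi_asin] at the angles [0] and [PI] cover the circle. *)
Lemma expi_surj (z : C) : onT z -> exists t, z = expi t.
Proof.
intros Hz. destruct (Rle_lt_dec 0 (fst z)) as [H|H].
- eexists. apply (expi_asin 0 z Hz). simpl. rewrite cos_0, sin_0. lra.
- eexists. apply (expi_asin PI z Hz). simpl. rewrite cos_PI, sin_PI. lra.
Qed.

Lemma asin_small (eta : R) : 0 < eta -> exists d, 0 < d /\ forall s, -1 <= s <= 1 -> Rabs s < d -> Rabs (asin s) < eta.
Proof.
intros Heta. pose proof PI2_1 as HPI.
set (e := Rmin eta 1). assert (He : 0 < e) by (apply Rmin_pos; lra).
assert (He1 : e <= 1) by apply Rmin_r. assert (He2 : e <= eta) by apply Rmin_l.
exists (sin e). split; [apply sin_gt_0; lra|].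
intros s Hs Hlt. apply Rabs_def2 in Hlt. destruct Hlt as [H1 H2].
pose proof (asin_bound s) as Hb.
apply Rabs_def1.
- apply Rlt_le_trans with e; [|assumption]. apply Rnot_le_lt; intros Hle.
  assert (sin e <= sin (asin s)) by (apply sin_incr_1; lra).
  rewrite sin_asin in H by assumption. lra.
- apply Rle_lt_trans with (- e); [lra|]. apply Rnot_le_lt; intros Hle.
  assert (sin (asin s) <= sin (- e)) by (apply sin_incr_1; lra).
  rewrite sin_asin, sin_neg in H by assumption. lra.
Qed.

(** [Ck] speaks of angles and extensions speak of points; this local inverse carries continuity from
    the former to the latter. Within distance 1 of [expi t0] the quotient has positive real part, so
    the arcsine chart applies. *)
Lemma expi_local_inverse (t0 eta : R) : 0 < eta -> exists d, 0 < d /\ forall w,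
  onT w -> Cmod (w - expi t0) < d -> exists t, Rabs (t - t0) < eta /\ w = expi t.
Proof.
intros Heta. destruct (asin_small eta Heta) as [d [Hd H]].
exists (Rmin 1 d). split; [apply Rmin_pos; lra|]. intros w Hw Hwd.
pose proof (Rmin_l 1 d). pose proof (Rmin_r 1 d).
set (q := (w * Cconj (expi t0))%C).
pose proof (onT_expi t0) as Hexp. change (Cmod (expi t0) = 1) in Hexp.
assert (Hq : Cmod (q - 1) < Rmin 1 d).
{ replace (q - 1)%C with ((w - expi t0) * Cconj (expi t0))%C.
  - rewrite Cmod_mult, Cmod_conj, Hexp. lra.
  - unfold q. transitivity (w * Cconj (expi t0) - expi t0 * Cconj (expi t0))%C; [ring|].
    rewrite <- Cmod2_conj, Hexp, pow1. reflexivity. }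
pose proof (Rle_lt_trans _ _ _ (Rabs_fst_le _) Hq) as Hf.
pose proof (Rle_lt_trans _ _ _ (Rabs_snd_le _) Hq) as Hs.
change (fst (q - 1)%C) with (fst q - 1) in Hf.
replace (snd (q - 1)%C) with (snd q) in Hs by (unfold q; simpl; ring).
apply Rabs_def2 in Hf.
exists (t0 + asin (snd q)). split.
- replace (t0 + asin (snd q) - t0) with (asin (snd q)) by ring.
  apply H; [|lra]. apply Rabs_le_between. lra.
- apply expi_asin; [assumption|]. fold q. lra.
Qed.

Lemma Ck_cont_T (k : option nat) (u : C -> C) (z : C) :
  Ck k u -> onT z -> cont_within onT u z.
Proof.
intros [D [HD0 HD]] Hz eps Heps.
destruct (expi_surj z Hz) as [t0 ->].
assert (H0 : le_k 0 k) by (destruct k; simpl; [lia|trivial]).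
destruct (HD 0%nat H0) as [[Hc1 Hc2] _].
destruct (Hc1 t0 (eps / 2) ltac:(lra)) as [d1 [Hd1 K1]].
destruct (Hc2 t0 (eps / 2) ltac:(lra)) as [d2 [Hd2 K2]].
destruct (expi_local_inverse t0 (Rmin d1 d2) (Rmin_pos _ _ Hd1 Hd2)) as [d [Hd K]].
exists d. split; [assumption|]. intros w Hw Hwd.
destruct (K w Hw Hwd) as [t [Ht ->]].
pose proof (Rmin_l d1 d2). pose proof (Rmin_r d1 d2).
rewrite <- !HD0.
destruct (Req_dec t t0) as [->|Hne].
{ change (Cmod (D 0%nat t0 - D 0%nat t0) < eps). rewrite Cmod_sub_diag. assumption. }
assert (Hx : forall d', Rmin d1 d2 <= d' -> D_x no_cond t0 t /\ Rdist t t0 < d').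
{ intros d' Hd'. split; [split; [exact I|auto]|]. unfold Rdist. lra. }
specialize (K1 t (Hx d1 ltac:(lra))). specialize (K2 t (Hx d2 ltac:(lra))).
simpl in K1, K2. unfold Rdist in K1, K2.
change (Cmod (D 0%nat t - D 0%nat t0) < eps).
eapply Rle_lt_trans; [apply Cmod_le_abs2|].
change (Rabs (fst (D 0%nat t) - fst (D 0%nat t0)) + Rabs (snd (D 0%nat t) - snd (D 0%nat t0)) < eps). lra.
Qed.

(** * Derivative sequences and the seminorms of [C^k(T)] *)

Lemma le_k_trans (l m : nat) (k : option nat) : (l <= m)%nat -> le_k m k -> le_k l k.
Proof. destruct k; simpl; [lia|trivial]. Qed.

(** [Ck_close] quantifies over all derivative sequences; up to order [k] they coincide, so a bound
    may be checked on any convenient one. *)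
Lemma derseq_unique (k : option nat) (f : R -> C) (D D' : nat -> R -> C) (l : nat) :
  is_derseq k f D -> is_derseq k f D' -> le_k l k -> forall t, D l t = D' l t.
Proof.
intros [H0 H] [H0' H'] . induction l as [|l IH]; intros Hl t.
- rewrite H0, H0'. reflexivity.
- assert (Hl' : le_k l k) by (apply (le_k_trans l (S l)); [lia|assumption]).
  destruct (proj2 (H l Hl') Hl t) as [A1 A2].
  destruct (proj2 (H' l Hl') Hl t) as [B1 B2].
  assert (E : forall s, D' l s = D l s) by (intros s; symmetry; apply IH; assumption).
  apply injective_projections; eapply uniqueness_limite.
  + exact A1.
  + apply is_derive_Reals. apply (is_derive_ext (fun s => fst (D' l s))).
    * intros s. rewrite E. reflexivity.
    * apply is_derive_Reals, B1.
  + exact A2.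
  + apply is_derive_Reals. apply (is_derive_ext (fun s => snd (D' l s))).
    * intros s. rewrite E. reflexivity.
    * apply is_derive_Reals, B2.
Qed.

Lemma Ck_close_refl (k : option nat) (N : nat) (eps : R) (u : C -> C) :
  le_k N k -> 0 <= eps -> Ck_close k N eps u u.
Proof.
intros HN He Du Dv Hu Hv l Hl t.
rewrite (derseq_unique k _ Du Dv l Hu Hv (le_k_trans _ _ _ Hl HN)).
change (Cmod (Dv l t - Dv l t) <= eps). rewrite Cmod_sub_diag. assumption.
Qed.

Lemma Ck_close_trans (k : option nat) (N : nat) (e1 e2 : R) (u v w : C -> C) :
  Ck k v -> Ck_close k N e1 u v -> Ck_close k N e2 v w -> Ck_close k N (e1 + e2) u w.
Proof.
intros [Dv Hv] H1 H2 Du Dw Hu Hw l Hl t.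
specialize (H1 Du Dv Hu Hv l Hl t). specialize (H2 Dv Dw Hv Hw l Hl t).
change (Cmod (Du l t - Dw l t) <= e1 + e2).
eapply Rle_trans; [apply (Cmod_sub_triangle _ (Dv l t))|].
change (Cmod (Du l t - Dv l t) <= e1) in H1. change (Cmod (Dv l t - Dw l t) <= e2) in H2. lra.
Qed.

Lemma Ck_close_sup (k : option nat) (N : nat) (eps : R) (u v : C -> C) (z : C) :
  Ck k u -> Ck k v -> Ck_close k N eps u v -> onT z -> Cmod (u z - v z) <= eps.
Proof.
intros [Du Hu] [Dv Hv] H Hz. destruct (expi_surj z Hz) as [t ->].
specialize (H Du Dv Hu Hv 0%nat ltac:(lia) t).
rewrite (proj1 Hu), (proj1 Hv) in H. exact H.
Qed.

(** * Open and compact sets in the plane *)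

Lemma Copen_inter (G H : C -> Prop) : Copen G -> Copen H -> Copen (fun z => G z /\ H z).
Proof.
intros HG HH z [Gz Hz]. destruct (HG z Gz) as [d1 [Hd1 K1]]. destruct (HH z Hz) as [d2 [Hd2 K2]].
exists (Rmin d1 d2); split; [apply Rmin_pos; assumption|]. intros w Hw.
pose proof (Rmin_l d1 d2). pose proof (Rmin_r d1 d2). split; [apply K1|apply K2]; lra.
Qed.

Lemma Ccompact_inter (K F : C -> Prop) :
  Ccompact K -> Copen (fun z => ~ F z) -> Ccompact (fun z => K z /\ F z).
Proof.
intros [[b Hb] HK] HF. split.
- exists b. intros z [Kz _]. auto.
- intros z Hz. destruct (classic (K z)) as [Kz|nKz].
  + destruct (HF z) as [d [Hd H]]; [tauto|]. exists d; split; [assumption|].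
    intros w Hw [_ Fw]. exact (H w Hw Fw).
  + destruct (HK z nKz) as [d [Hd H]]. exists d; split; [assumption|].
    intros w Hw [Kw _]. exact (H w Hw Kw).
Qed.

Lemma Copen_not_ge (c : C) (s : R) : Copen (fun z => ~ s <= Cmod (z - c)).
Proof.
intros z Hz. apply Rnot_le_lt in Hz. destruct (open_disc_open c s z Hz) as [d [Hd H]].
exists d; split; [assumption|]. intros w Hw. specialize (H w Hw). simpl in H. lra.
Qed.

Lemma Copen_gt (c : C) (s : R) : Copen (fun z => s < Cmod (z - c)).
Proof.
intros z Hz. exists (Cmod (z - c) - s). split; [lra|]. intros w Hw.
pose proof (Cmod_sub_triangle z w c) as T. rewrite (Cmod_sub_sym z w) in T. lra.
Qed.

Lemma Cmod_sub_0 (z : C) : Cmod (z - 0) = Cmod z.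
Proof. f_equal. ring. Qed.

Lemma Copen_gt_1 : Copen (fun z => 1 < Cmod z).
Proof.
intros z Hz. rewrite <- Cmod_sub_0 in Hz. destruct (Copen_gt _ _ z Hz) as [d [Hd H]].
exists d; split; [assumption|]. intros w Hw. rewrite <- Cmod_sub_0. exact (H w Hw).
Qed.

Lemma Copen_not_ge_1 : Copen (fun z => ~ 1 <= Cmod z).
Proof.
intros z Hz. rewrite <- Cmod_sub_0 in Hz. destruct (Copen_not_ge _ _ z Hz) as [d [Hd H]].
exists d; split; [assumption|]. intros w Hw. rewrite <- Cmod_sub_0. exact (H w Hw).
Qed.

Lemma Omega_open (z0 : C) (r : R) : Copen (Omega z0 r).
Proof. apply (Copen_inter (fun z => Cmod (z - z0) < r)); [apply open_disc_open|apply Copen_gt_1]. Qed.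

Lemma holomorphic_on_holo_at (S : C -> Prop) (f : C -> C) (z : C) :
  Copen S -> holomorphic_on S f -> S z -> holo_at f z.
Proof.
intros HS Hf Hz. destruct (Hf z Hz) as [l Hl]. exists l. apply is_derive_C_iff.
intros eps Heps. destruct (Hl eps Heps) as [d1 [Hd1 H1]]. destruct (HS z Hz) as [d2 [Hd2 H2]].
exists (Rmin d1 d2); split; [apply Rmin_pos; assumption|]. intros w Hw.
pose proof (Rmin_l d1 d2). pose proof (Rmin_r d1 d2).
apply (H1 w); [apply H2; lra|]. change (Cmod (w - z) < d1). lra.
Qed.

Lemma holo_at_holomorphic_on (S : C -> Prop) (f : C -> C) :
  (forall z, S z -> holo_at f z) -> holomorphic_on S f.
Proof.
intros Hf z Hz. destruct (Hf z Hz) as [l Hl]. exists l. intros eps Heps.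
destruct (proj1 (is_derive_C_iff f z l) Hl eps Heps) as [d [Hd H]].
exists d; split; [assumption|]. intros w _ Hw. exact (H w Hw).
Qed.

(** * Extensions across [z0], and extensions with a bound *)

Definition extends (z0 : C) (r : R) (u lam : C -> C) : Prop :=
  (forall z, (onT z \/ Omega z0 r z) ->
     cont_within (fun w => onT w \/ Omega z0 r w) lam z) /\
  holomorphic_on (Omega z0 r) lam /\
  (forall z, onT z -> Cmod (z - z0) < r -> lam z = u z).

Lemma extends_shrink (z0 : C) (r r' : R) (u lam : C -> C) :
  r' <= r -> extends z0 r u lam -> extends z0 r' u lam.
Proof.
intros Hr (H1 & H2 & H3).
assert (HO : forall z, Omega z0 r' z -> Omega z0 r z).
{ intros z [A B]. split; [lra|assumption]. }
split; [|split].
- intros z Hz. apply (cont_within_subset (fun w => onT w \/ Omega z0 r w)).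
  + intros w [Hw|Hw]; auto.
  + apply H1. destruct Hz; auto.
- apply holo_at_holomorphic_on. intros z Hz.
  apply (holomorphic_on_holo_at (Omega z0 r)); auto. apply Omega_open.
- intros z Hz Hzr. apply H3; [assumption|lra].
Qed.

Definition bounded_extends (z0 : C) (n : nat) (u : C -> C) : Prop :=
  exists lam, extends z0 (/ (INR n + 1)) u lam /\
    forall z, 1 <= Cmod z -> Cmod (z - z0) < / (INR n + 1) -> Cmod (lam z) <= INR n.

Lemma onT_or_Omega (z0 z : C) (r : R) :
  1 <= Cmod z -> Cmod (z - z0) < r -> onT z \/ Omega z0 r z.
Proof.
intros H1 H2. destruct (Req_dec (Cmod z) 1) as [E|E]; [left; exact E|right].
split; [exact H2|]. change (1 < Cmod z). lra.
Qed.

Lemma extends_bounded (z0 : C) (r : R) (u lam : C -> C) :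
  onT z0 -> 0 < r -> extends z0 r u lam -> exists n, bounded_extends z0 n u.
Proof.
intros Hz0 Hr Hext.
destruct (cont_withinE _ _ _ (proj1 Hext z0 (or_introl Hz0)) 1 ltac:(lra)) as [d [Hd H]].
set (e := Rmin r d). assert (He : 0 < e) by (apply Rmin_pos; assumption).
(* One index meets two requirements, [1 / (n + 1) <= e] and [|lam z0| + 1 <= n]. *)
destruct (INR_unbounded (/ e + Cmod (lam z0) + 1)) as [n Hn].
assert (Hie : 0 < / e) by (apply Rinv_0_lt_compat; assumption).
pose proof (Cmod_ge_0 (lam z0)) as Hl0.
assert (Hne : / (INR n + 1) <= e).
{ rewrite <- (Rinv_inv e). apply Rinv_le_contravar; lra. }
pose proof (Rmin_l r d) as M1. pose proof (Rmin_r r d) as M2. fold e in M1, M2.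
exists n, lam. split; [apply (extends_shrink z0 r); [lra|assumption]|].
intros z Hz1 Hz. assert (Hzr : Cmod (z - z0) < r) by lra.
specialize (H z (onT_or_Omega z0 z r Hz1 Hzr) ltac:(lra)).
pose proof (Cmod_triangle (lam z - lam z0) (lam z0)) as T.
replace (lam z - lam z0 + lam z0)%C with (lam z) in T by ring. lra.
Qed.

(** * The lens at [z0] and limits of extensions *)

(** The disc of radius [1/2] about [z0 / 2] touches the circle from inside at [z0], so a slightly
    larger one leaves the unit disc only near [z0]. Precisely, [|z - z0|^2 = 2 (|z - z0/2|^2 - 1/4)
    + 1 - |z|^2]. *)
Lemma lens_near (z0 z : C) (tau : R) :
  onT z0 -> 1 <= Cmod z -> 0 < tau <= 1 -> Cmod (z - z0 * RtoC (/ 2)) <= 1 / 2 + tau ->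
  Cmod (z - z0) ^ 2 <= 4 * tau.
Proof.
intros Hz0 Hz Htau Hd. apply onT_sqr in Hz0.
assert (H1 : 1 <= Cmod z ^ 2) by nra.
assert (H2 : Cmod (z - z0 * RtoC (/ 2)) ^ 2 <= (1 / 2 + tau) ^ 2).
{ apply pow_incr. split; [apply Cmod_ge_0|assumption]. }
rewrite Cmod_sqr in H1, H2 |- *. simpl fst in *; simpl snd in *. nra.
Qed.

(* The function [R / (z - z0/2)] with [R > 1/2] has modulus 1 on the part of the boundary of the lens
   [|z| > 1, |z - z0/2| < R] lying off the unit circle, and modulus at least [q > 1] near [z0]. *)
Lemma lens_estimate (z0 : C) (r M : R) :
  onT z0 -> 0 < r -> 0 <= M ->
  exists rho, 0 < rho /\ rho <= r /\ forall eta, 0 < eta -> exists eps, 0 < eps /\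
    forall h, (forall z, (onT z \/ Omega z0 r z) ->
                 cont_within (fun w => onT w \/ Omega z0 r w) h z) ->
      (forall z, Omega z0 r z -> holo_at h z) ->
      (forall z, 1 <= Cmod z -> Cmod (z - z0) < r -> Cmod (h z) <= M) ->
      (forall z, onT z -> Cmod (z - z0) < r -> Cmod (h z) <= eps) ->
      forall z, 1 <= Cmod z -> Cmod (z - z0) < rho -> Cmod (h z) <= eta.
Proof.
intros Hz0 Hr HM.
(* With [tau <= r^2 / 8], [lens_near] gives [|z - z0|^2 <= r^2 / 2] on the lens, which therefore
   stays inside [D(z0, r)]. *)
set (tau := Rmin 1 (r ^ 2 / 8)).
assert (Hr2 : 0 < r ^ 2) by (apply pow_lt; assumption).
assert (Ht : 0 < tau) by (apply Rmin_pos; lra).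
assert (Ht1 : tau <= 1) by apply Rmin_l.
assert (Ht2 : tau <= r ^ 2 / 8) by apply Rmin_r.
assert (Hlens : forall z, 1 <= Cmod z -> Cmod (z - z0 * RtoC (/ 2)) <= 1 / 2 + tau -> Cmod (z - z0) < r).
{ intros z H1 H2. pose proof (lens_near z0 z tau Hz0 H1 (conj Ht Ht1) H2).
  apply Rnot_le_lt; intros Hle. assert (r ^ 2 <= Cmod (z - z0) ^ 2) by (apply pow_incr; lra). lra. }
set (p := (z0 * RtoC (/ 2))%C) in *. set (R0 := 1 / 2 + tau) in *.
assert (HR0 : 0 < R0) by (unfold R0; lra).
change (Cmod z0 = 1) in Hz0.
assert (Hp : Cmod p = 1 / 2).
{ unfold p. rewrite Cmod_mult, Hz0, Cmod_R, Rabs_pos_eq; lra. }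
assert (Hzp : forall z, 1 <= Cmod z -> 1 / 2 <= Cmod (z - p)).
{ intros z Hz. pose proof (Cmod_triangle (z - p) p) as T. replace (z - p + p)%C with z in T by ring. lra. }
set (g := fun z => (RtoC R0 * / (z - p))%C).
assert (Hg : forall z, 1 <= Cmod z -> Cmod (g z) = R0 / Cmod (z - p)).
{ intros z Hz. specialize (Hzp z Hz). unfold g. rewrite Cmod_mult, Cmod_inv, Cmod_R, Rabs_pos_eq; try lra.
  apply Cmod_gt_0; lra. }
assert (Hgh : forall z, 1 <= Cmod z -> holo_at g z).
{ intros z Hz. apply (holo_at_mult (fun _ => RtoC R0)); [apply holo_at_const|].
  apply holo_at_inv. intros ->. specialize (Hzp p Hz). rewrite Cmod_sub_diag in Hzp. lra. }
(* A lower bound of [|g|] at the points outside the unit disc within [tau / 2] of [z0], where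
   [|z - p| <= 1/2 + tau/2]. *)
set (q := R0 / (1 / 2 + tau / 2)).
assert (Hq : 1 < q).
{ unfold q. apply Rmult_lt_reg_r with (1 / 2 + tau / 2); [lra|].
  unfold Rdiv at 3. rewrite Rmult_assoc, Rinv_l by lra. unfold R0; lra. }
assert (Htr : tau / 2 <= r).
{ destruct (Rle_lt_dec 1 r) as [H|H]; [lra|]. nra. }
exists (tau / 2). split; [lra|split; [exact Htr|]]. intros eta Heta.
(* The exponent gives [M <= (eta / 2) q^n], and [eps] will make the second term of the two-constants
   bound equal to [eta / 2]. As [rho] is fixed before [eta], all tolerances share one neighbourhood
   of [z0]. *)
destruct (Pow_x_infinity q ltac:(rewrite Rabs_pos_eq; lra) (2 * M / eta)) as [n Hn].
specialize (Hn n (le_n n)). rewrite Rabs_pos_eq in Hn by (apply pow_le; lra).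
set (L := 2 * R0).
assert (HL : 0 < L ^ n) by (apply pow_lt; unfold L; lra).
exists (eta / (2 * L ^ n)). split; [apply Rdiv_lt_0_compat; lra|].
intros h hc hh hM he z Hz1 Hz.
set (K := fun z => Cmod (z - p) <= R0 /\ 1 <= Cmod z).
set (G := fun z => Cmod (z - p) < R0 /\ 1 < Cmod z).
assert (HKr : forall w, K w -> onT w \/ Omega z0 r w).
{ intros w [A B]. apply onT_or_Omega; auto. }
assert (Hzp2 : Cmod (z - p) <= 1 / 2 + tau / 2).
{ pose proof (Cmod_sub_triangle z z0 p) as T.
  replace (z0 - p)%C with p in T. 2:{ unfold p. apply injective_projections; simpl; field. }
  lra. }
assert (Est : Cmod (h z) * Cmod (g z) ^ n <= M + eta / (2 * L ^ n) * L ^ n).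
{ apply (two_constants K G); try lra.
  - apply Ccompact_inter; [apply closed_disc_compact|apply Copen_not_ge_1].
  - apply Copen_inter; [apply open_disc_open|apply Copen_gt_1].
  - intros w [A B]. split; lra.
  - left. apply Rdiv_lt_0_compat; lra.
  - intros w Kw. apply (cont_within_subset (fun w => onT w \/ Omega z0 r w)); auto.
  - intros w [_ Kw]. apply cont_at_within, holo_at_cont_at, Hgh, Kw.
  - intros w [A B]. apply hh. split; [|exact B]. apply (Hlens w); lra.
  - intros w [A B]. apply Hgh. lra.
  - intros w [A B]. rewrite Hg by assumption. specialize (Hzp w B).
    apply Rmult_le_reg_r with (Cmod (w - p)); [lra|].
    unfold Rdiv. rewrite Rmult_assoc, Rinv_l by lra. unfold L. nra.
  - intros w [A B] nG. destruct (Rle_lt_or_eq_dec _ _ B) as [B'|B'].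
    + left. split; [apply hM; auto|]. rewrite Hg by assumption.
      destruct (Rle_lt_or_eq_dec _ _ A) as [A'|A']; [exfalso; apply nG; split; assumption|].
      rewrite A'. right. field. lra.
    + right. apply he; [symmetry; exact B'|auto].
  - split; [unfold R0; lra|assumption]. }
replace (eta / (2 * L ^ n) * L ^ n) with (eta / 2) in Est by (field; lra).
assert (Hgq : q ^ n <= Cmod (g z) ^ n).
{ apply pow_incr. split; [lra|]. rewrite Hg by assumption. unfold q, Rdiv.
  apply Rmult_le_compat_l; [lra|]. specialize (Hzp z Hz1). apply Rinv_le_contravar; lra. }
assert (Hq1 : 1 <= q ^ n) by (apply pow_R1_Rle; lra).
pose proof (Cmod_ge_0 (h z)).
assert (HMq : M <= eta / 2 * q ^ n).
{ apply Rge_le in Hn. apply (Rmult_le_compat_l (eta / 2)) in Hn; [|lra].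
  replace (eta / 2 * (2 * M / eta)) with M in Hn by (field; lra). assumption. }
apply Rnot_lt_le; intros Hlt. nra.
Qed.

Lemma limit_extends (z0 : C) (r M : R) (u : C -> C) (v lam : nat -> C -> C) :
  onT z0 -> 0 < r -> 0 <= M ->
  (forall z, onT z -> cont_within onT u z) ->
  (forall eps, 0 < eps -> exists N, forall n z, (N <= n)%nat -> onT z -> Cmod (v n z - u z) <= eps) ->
  (forall n, extends z0 r (v n) (lam n)) ->
  (forall n z, 1 <= Cmod z -> Cmod (z - z0) < r -> Cmod (lam n z) <= M) ->
  exists r' F, 0 < r' /\ extends z0 r' u F.
Proof.
intros Hz0 Hr HM Hu Hv Hext Hb.
destruct (lens_estimate z0 r (2 * M) Hz0 Hr ltac:(lra)) as (rho & Hrho & Hrr & Hest).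
set (P := fun z => 1 <= Cmod z /\ Cmod (z - z0) < rho).
assert (HPr : forall z, P z -> onT z \/ Omega z0 r z).
{ intros z [A B]. apply onT_or_Omega; lra. }
assert (Hcau : forall eta, 0 < eta -> exists N, forall i j z, (N <= i)%nat -> (N <= j)%nat -> P z ->
  Cmod (lam i z - lam j z) <= eta).
{ intros eta Heta. destruct (Hest eta Heta) as (eps & Heps & H).
  destruct (Hv (eps / 2) ltac:(lra)) as [N HN]. exists N. intros i j z Hi Hj [Hz1 Hz].
  destruct (Hext i) as (Ci & Hhi & Ei). destruct (Hext j) as (Cj & Hhj & Ej).
  apply (H (fun z => lam i z - lam j z)%C); auto.
  - intros w Hw. apply cont_within_minus; auto.
  - intros w Hw. apply holo_at_minus; apply (holomorphic_on_holo_at (Omega z0 r)); auto using Omega_open.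
  - intros w Hw1 Hw. pose proof (Cmod_triangle (lam i w) (- lam j w)) as T. rewrite Cmod_opp in T.
    pose proof (Hb i w Hw1 Hw). pose proof (Hb j w Hw1 Hw). unfold Cminus. lra.
  - intros w Hw1 Hw. rewrite Ei, Ej by assumption.
    pose proof (HN i w Hi Hw1). pose proof (HN j w Hj Hw1).
    pose proof (Cmod_sub_triangle (v i w) (u w) (v j w)) as T. rewrite (Cmod_sub_sym (u w)) in T. lra. }
assert (Hlim : forall z, exists l, P z -> Clim (fun n => lam n z) l).
{ intros z. destruct (classic (P z)) as [Pz|nPz]; [|exists 0%C; tauto].
  destruct (Ccauchy_cv (fun n => lam n z)) as [l Hl]; [|exists l; auto].
  intros eps Heps. destruct (Hcau eps Heps) as [N HN]. exists N. intros i j Hi Hj. auto. }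
apply functional_choice in Hlim. destruct Hlim as [F0 HF0].
(* The value on [T] is [u] everywhere, also far from [z0], where the [lam n] need not converge. *)
set (F := fun z : C => if excluded_middle_informative (onT z) then u z else F0 z).
assert (HFT : forall z, onT z -> F z = u z).
{ intros z Hz. unfold F. destruct (excluded_middle_informative _); tauto. }
assert (HF : forall z, P z -> Clim (fun n => lam n z) (F z)).
{ intros z Pz. unfold F. destruct (excluded_middle_informative _) as [Tz|_]; [|auto].
  intros eps Heps. destruct (Hv eps Heps) as [N HN]. exists N. intros n Hn.
  destruct (Hext n) as (_ & _ & E). rewrite E; auto. destruct Pz; lra. }
assert (HFu : forall eta, 0 < eta -> exists N, forall n z, (N <= n)%nat -> P z -> Cmod (lam n z - F z) <= eta).
{ intros eta Heta. destruct (Hcau eta Heta) as [N HN]. exists N. intros n z Hn Pz.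
  rewrite Cmod_sub_sym. apply (Clim_bound (fun n => lam n z) _ _ _ N); auto. }
(* Halving the radius leaves a gap: a point of [T] at distance at least [rho] from [z0] has a
   neighbourhood free of [Omega z0 (rho / 2)], so continuity there is that of [u] on [T]. *)
exists (rho / 2), F. split; [lra|]. split; [|split].
- intros z Hz. destruct (Rlt_le_dec (Cmod (z - z0)) rho) as [Hzr|Hzr].
  + assert (Pz : P z).
    { split; [|assumption]. destruct Hz as [Tz|[_ Oz]]; [right; symmetry; exact Tz|left; exact Oz]. }
    intros eps Heps. destruct (HFu (eps / 3) ltac:(lra)) as [N HN].
    destruct (cont_withinE _ _ _ (proj1 (Hext N) z (HPr z Pz)) (eps / 3) ltac:(lra)) as [d [Hd Hc]].
    exists (Rmin d (rho - Cmod (z - z0))). split; [apply Rmin_pos; lra|]. intros w Hw Hwz.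
    change (Cmod (w - z) < Rmin d (rho - Cmod (z - z0))) in Hwz.
    pose proof (Rmin_l d (rho - Cmod (z - z0))). pose proof (Rmin_r d (rho - Cmod (z - z0))).
    assert (Pw : P w).
    { split.
      - destruct Hw as [Tw|[_ Ow]]; [right; symmetry; exact Tw|left; exact Ow].
      - pose proof (Cmod_sub_triangle w z z0). lra. }
    specialize (Hc w (HPr w Pw) ltac:(lra)).
    pose proof (HN N w (le_n N) Pw) as E1. pose proof (HN N z (le_n N) Pz) as E2.
    change (Cmod (F w - F z) < eps).
    pose proof (Cmod_sub_triangle (F w) (lam N w) (F z)).
    pose proof (Cmod_sub_triangle (lam N w) (lam N z) (F z)).
    rewrite (Cmod_sub_sym (F w) (lam N w)) in *. lra.
  + assert (Tz : onT z).
    { destruct Hz as [Tz|[Oz _]]; [assumption|]. change (Cmod (z - z0) < rho / 2) in Oz. lra. }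
    intros eps Heps. destruct (cont_withinE _ _ _ (Hu z Tz) eps Heps) as [d [Hd Hc]].
    exists (Rmin d (rho / 2)). split; [apply Rmin_pos; lra|]. intros w Hw Hwz.
    change (Cmod (w - z) < Rmin d (rho / 2)) in Hwz.
    pose proof (Rmin_l d (rho / 2)). pose proof (Rmin_r d (rho / 2)).
    assert (Tw : onT w).
    { destruct Hw as [Tw|[Ow _]]; [assumption|]. change (Cmod (w - z0) < rho / 2) in Ow.
      pose proof (Cmod_sub_triangle z w z0). rewrite (Cmod_sub_sym z w) in *. lra. }
    rewrite !HFT by assumption. apply Hc; [assumption|lra].
- apply holo_at_holomorphic_on. intros z Hz.
  destruct (Omega_open z0 rho z) as [d [Hd HO]].
  { destruct Hz as [A B]. change (Cmod (z - z0) < rho / 2) in A. split; [|exact B].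
    change (Cmod (z - z0) < rho). lra. }
  apply (uniform_limit_holo lam F z d Hd).
  + intros j w Hw. apply (holomorphic_on_holo_at (Omega z0 r)); [apply Omega_open|apply Hext|].
    destruct (HO w Hw) as [A B]. split; [|exact B]. change (Cmod (w - z0) < rho) in A.
    change (Cmod (w - z0) < r). lra.
  + intros eps Heps. destruct (HFu eps Heps) as [N HN]. exists N. intros j w Hj Hw.
    apply HN; [assumption|]. destruct (HO w Hw) as [A B]. split; [left; exact B|exact A].
- intros z Hz _. apply HFT, Hz.
Qed.

(** Closeness here is uniform distance on [T], the weakest of the seminorms, so the statement covers
    every [k]. A sequence with errors [1 / (j + 1)] feeds [limit_extends]. *)
Lemma bounded_extends_closed (z0 : C) (n : nat) (u : C -> C) :
  onT z0 -> (forall z, onT z -> cont_within onT u z) ->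
  (forall eps, 0 < eps -> exists v, bounded_extends z0 n v /\
     forall z, onT z -> Cmod (u z - v z) <= eps) ->
  exists r F, 0 < r /\ extends z0 r u F.
Proof.
intros Hz0 Hu H.
assert (Hpos : forall j, 0 < / (INR j + 1)).
{ intros j. pose proof (pos_INR j). apply Rinv_0_lt_compat. lra. }
assert (Hj : forall j, exists vl : (C -> C) * (C -> C),
  extends z0 (/ (INR n + 1)) (fst vl) (snd vl) /\
  (forall z, 1 <= Cmod z -> Cmod (z - z0) < / (INR n + 1) -> Cmod (snd vl z) <= INR n) /\
  (forall z, onT z -> Cmod (u z - fst vl z) <= / (INR j + 1))).
{ intros j. destruct (H _ (Hpos j)) as (v & (lam & H1 & H2) & H3). exists (v, lam). auto. }
apply functional_choice in Hj. destruct Hj as [vl Hvl].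
apply (limit_extends z0 (/ (INR n + 1)) (INR n) u (fun j => fst (vl j)) (fun j => snd (vl j))); auto using pos_INR.
- intros eps Heps. destruct (INR_unbounded (/ eps)) as [N HN]. exists N. intros j z Hj Hz.
  rewrite Cmod_sub_sym. eapply Rle_trans; [apply Hvl; assumption|].
  apply le_INR in Hj. assert (0 < / eps) by (apply Rinv_0_lt_compat; assumption).
  rewrite <- (Rinv_inv eps). apply Rinv_le_contravar; lra.
- apply Hvl.
- intros j. apply Hvl.
Qed.

(** * [U2] as a countable intersection of open sets *)

Lemma U2_iff (z0 : C) (k : option nat) (u : C -> C) :
  U2 z0 k u <-> Ck k u /\ ~ exists r F, 0 < r /\ extends z0 r u F.
Proof.
split; intros [H1 H2]; split; try assumption; intros H; apply H2.
- destruct H as (r & F & Hr & HF). exists r. split; [assumption|]. exists F. exact HF.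
- destruct H as (r & Hr & F & HF). exists r, F. split; [assumption|exact HF].
Qed.

Lemma U2_Gdelta (z0 : C) (k : option nat) : onT z0 -> Ck_Gdelta k (U2 z0 k).
Proof.
intros Hz0. split; [intros u [Hu _]; exact Hu|].
(* The interior of the complement of [E_n] in [C^k(T)], written out with seminorm balls; halving
   [eps] shows it open. *)
exists (fun n u => exists N, le_k N k /\ exists eps, 0 < eps /\
  forall v, Ck k v -> Ck_close k N eps u v -> ~ bounded_extends z0 n v).
split.
- intros n u Hu (N & HN & eps & Heps & H). exists N; split; [assumption|].
  exists (eps / 2); split; [lra|]. intros v Hv Huv. exists N; split; [assumption|].
  exists (eps / 2); split; [lra|]. intros w Hw Hvw. apply H; [assumption|].
  replace eps with (eps / 2 + eps / 2) by field. apply (Ck_close_trans k N _ _ u v); assumption.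
- intros u Hu. rewrite U2_iff. split.
  + intros [_ Hne] n. apply NNPP; intros Hn. apply Hne.
    apply (bounded_extends_closed z0 n u Hz0).
    * intros z Hz. apply (Ck_cont_T k); assumption.
    * intros eps Heps. apply NNPP; intros Hno. apply Hn.
      (* A ball of the seminorm of order 0 is the witness: if every such ball met [E_n], then [u]
         would be a uniform limit of elements of [E_n]. *)
      exists 0%nat. split; [destruct k; simpl; [lia|trivial]|].
      exists eps; split; [assumption|]. intros v Hv Huv Hbe. apply Hno.
      exists v; split; [assumption|]. intros z Hz. apply (Ck_close_sup k 0 eps); assumption.
  + intros HA. split; [assumption|]. intros (r & F & Hr & HF).
    destruct (extends_bounded z0 r u F Hz0 Hr HF) as [n Hn].
    destruct (HA n) as (N & HN & eps & Heps & H).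
    apply (H u Hu); [|assumption]. apply Ck_close_refl; [assumption|lra].
Qed.

(** * A smooth one-sided bump *)

(** [e^(-1/x) x^(-m)] continued by 0. The powers are carried along because the derivative of a
    member is a combination of the members [m + 1] and [m + 2]. *)
Definition flat (m : nat) (x : R) : R :=
  if Rle_dec x 0 then 0 else exp (- / x) * (/ x) ^ m.

Lemma flat_nonpos (m : nat) (x : R) : x <= 0 -> flat m x = 0.
Proof. intros H. unfold flat. destruct (Rle_dec x 0); [reflexivity|tauto]. Qed.

Lemma flat_pos (m : nat) (x : R) : 0 < x -> flat m x = exp (- / x) * (/ x) ^ m.
Proof. intros H. unfold flat. destruct (Rle_dec x 0); [lra|reflexivity]. Qed.

(** [y <= e^y] at [y = u / (n + 1)], raised to the power [n + 1]. *)
Lemma exp_pow_le (n : nat) (u : R) : 0 < u -> (u / INR (S n)) ^ S n <= exp u.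
Proof.
intros Hu. assert (Hn : 0 < INR (S n)) by (apply lt_0_INR; lia).
assert (Hexp : forall x k, exp x ^ k = exp (INR k * x)).
{ intros x k. induction k as [|k IH]; [rewrite Rmult_0_l, exp_0; reflexivity|].
  rewrite S_INR, Rmult_plus_distr_r, Rmult_1_l, exp_plus, <- IH. simpl. ring. }
replace (exp u) with (exp (u / INR (S n)) ^ S n).
2:{ rewrite Hexp. f_equal. field. lra. }
apply pow_incr. split; [left; apply Rdiv_lt_0_compat; assumption|].
pose proof (exp_ineq1_le (u / INR (S n))). lra.
Qed.

(** [exp_pow_le] with exponent [m + 2] beats [x^(-m)] by two orders. The quadratic bound gives
    derivative 0 at the origin and, after composition with the sine, boundedness. *)
Lemma flat_bound (m : nat) (x : R) :
  Rabs (flat m x) <= INR (m + 2) ^ (m + 2) * x ^ 2.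
Proof.
assert (Hc : 0 <= INR (m + 2) ^ (m + 2)) by (apply pow_le, pos_INR).
destruct (Rle_lt_dec x 0) as [Hx|Hx].
- rewrite flat_nonpos by assumption. rewrite Rabs_R0. apply Rmult_le_pos; [assumption|apply pow2_ge_0].
- rewrite flat_pos by assumption.
  assert (Hi : 0 < / x) by (apply Rinv_0_lt_compat; assumption).
  assert (Hp : 0 < (/ x) ^ m) by (apply pow_lt; assumption).
  rewrite Rabs_pos_eq by (apply Rmult_le_pos; left; [apply exp_pos|assumption]).
  rewrite exp_Ropp.
  pose proof (exp_pow_le (S m) (/ x) Hi) as H. replace (S (S m)) with (m + 2)%nat in H by lia.
  assert (Hn : 0 < INR (m + 2)) by (apply lt_0_INR; lia).
  unfold Rdiv in H. rewrite Rpow_mult_distr, (pow_inv (INR (m + 2))), pow_add in H.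
  set (c := INR (m + 2) ^ (m + 2)) in *.
  assert (Hc' : 0 < c) by (apply pow_lt; assumption).
  apply Rmult_le_reg_l with (exp (/ x)); [apply exp_pos|].
  rewrite <- Rmult_assoc, Rinv_r, Rmult_1_l by (pose proof (exp_pos (/ x)); lra).
  apply Rmult_le_compat_r with (r := c * x ^ 2) in H.
  + replace ((/ x) ^ m * (/ x) ^ 2 * / c * (c * x ^ 2)) with ((/ x) ^ m) in H by (field; lra). exact H.
  + apply Rmult_le_pos; [assumption|apply pow2_ge_0].
Qed.

Lemma flat_derivable (m : nat) (x : R) :
  derivable_pt_lim (flat m) x (flat (m + 2) x + - INR m * flat (m + 1) x).
Proof.
destruct (Rtotal_order x 0) as [Hx|[Hx|Hx]].
- rewrite !flat_nonpos by lra. apply is_derive_Reals.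
  replace (0 + - INR m * 0) with 0 by ring.
  apply (is_derive_ext_loc (fun _ => 0)).
  + assert (Hx' : 0 < - x) by lra. exists (mkposreal _ Hx'). intros y Hy.
    change (Rabs (y - x) < - x) in Hy. apply Rabs_def2 in Hy. rewrite flat_nonpos by lra. reflexivity.
  + apply (is_derive_const (K := R_AbsRing) (V := R_NormedModule)).
- subst x. rewrite !flat_nonpos by lra.
  intros eps Heps. set (c := INR (m + 2) ^ (m + 2)).
  assert (Hc : 0 < c) by (apply pow_lt, lt_0_INR; lia).
  assert (Hd : 0 < eps / c) by (apply Rdiv_lt_0_compat; assumption).
  exists (mkposreal _ Hd). intros h Hh Hhd. simpl in Hhd.
  rewrite (flat_nonpos m 0) by lra. rewrite Rplus_0_l.
  replace ((flat m h - 0) / h - (0 + - INR m * 0)) with (flat m h / h) by (field; assumption).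
  unfold Rdiv. rewrite Rabs_mult, Rabs_inv.
  pose proof (flat_bound m h) as B. fold c in B.
  pose proof (Rabs_pos_lt h Hh) as Hp.
  replace (h ^ 2) with (Rabs h * Rabs h) in B by (rewrite <- Rabs_mult, Rabs_pos_eq; [ring|nra]).
  apply Rle_lt_trans with (c * Rabs h).
  + apply Rmult_le_reg_r with (Rabs h); [assumption|].
    rewrite Rmult_assoc, Rinv_l by lra. lra.
  + apply Rmult_lt_compat_l with (r := c) in Hhd; [|assumption].
    replace (c * (eps / c)) with eps in Hhd by (field; lra). assumption.
- rewrite !flat_pos by lra. apply is_derive_Reals.
  apply (is_derive_ext_loc (fun y => exp (- / y) * (/ y) ^ m)).
  + exists (mkposreal _ Hx). intros y Hy. change (Rabs (y - x) < x) in Hy. apply Rabs_def2 in Hy.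
    rewrite flat_pos by lra. reflexivity.
  + auto_derive; [lra|]. rewrite !pow_add.
    destruct m as [|m]; simpl; [field; lra|]. field; lra.
Qed.

(* Generators of an algebra closed under differentiation, which gives all derivatives of the bump at once. *)
Inductive trig_flat (t0 : R) : (R -> R) -> Prop :=
| tf_flat m : trig_flat t0 (fun t => flat m (sin (t - t0)))
| tf_cos : trig_flat t0 (fun t => cos (t - t0))
| tf_sin : trig_flat t0 (fun t => sin (t - t0))
| tf_const c : trig_flat t0 (fun _ => c)
| tf_plus f g : trig_flat t0 f -> trig_flat t0 g -> trig_flat t0 (fun t => f t + g t)
| tf_mult f g : trig_flat t0 f -> trig_flat t0 g -> trig_flat t0 (fun t => f t * g t).

Lemma trig_flat_derivable (t0 : R) (f : R -> R) : trig_flat t0 f ->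
  exists g, trig_flat t0 g /\ forall t, derivable_pt_lim f t (g t).
Proof.
assert (Hsub : forall t, derivable_pt_lim (fun t => t - t0) t 1).
{ intros t. apply is_derive_Reals. auto_derive; [trivial|unfold Rminus; ring]. }
induction 1 as [m| | |c|f g _ [f' [Hf Df]] _ [g' [Hg Dg]]|f g Tf [f' [Hf Df]] Tg [g' [Hg Dg]]].
- exists (fun t => (flat (m + 2) (sin (t - t0)) + - INR m * flat (m + 1) (sin (t - t0))) * cos (t - t0)).
  split.
  + apply tf_mult; [|apply tf_cos]. apply tf_plus; [apply tf_flat|].
    apply tf_mult; [apply tf_const|apply tf_flat].
  + intros t. apply (derivable_pt_lim_comp (fun t => sin (t - t0)) (flat m)); [|apply flat_derivable].
    apply is_derive_Reals. auto_derive; [trivial|unfold Rminus; ring].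
- exists (fun t => -1 * sin (t - t0)). split.
  + apply tf_mult; [apply tf_const|apply tf_sin].
  + intros t. apply is_derive_Reals. auto_derive; [trivial|unfold Rminus; ring].
- exists (fun t => cos (t - t0)). split; [apply tf_cos|].
  intros t. apply is_derive_Reals. auto_derive; [trivial|unfold Rminus; ring].
- exists (fun _ => 0). split; [apply tf_const|]. intros t. apply derivable_pt_lim_const.
- exists (fun t => f' t + g' t). split; [apply tf_plus; assumption|].
  intros t. apply derivable_pt_lim_plus; auto.
- exists (fun t => f' t * g t + f t * g' t). split.
  + apply tf_plus; apply tf_mult; assumption.
  + intros t. apply derivable_pt_lim_mult; auto.
Qed.

Lemma trig_flat_bounded (t0 : R) (f : R -> R) : trig_flat t0 f ->
  exists B, forall t, Rabs (f t) <= B.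
Proof.
induction 1 as [m| | |c|f g _ [B HB] _ [B' HB']|f g _ [B HB] _ [B' HB']].
- exists (INR (m + 2) ^ (m + 2)). intros t. eapply Rle_trans; [apply flat_bound|].
  pose proof (SIN_bound (t - t0)).
  assert (0 <= INR (m + 2) ^ (m + 2)) by (apply pow_le, pos_INR).
  assert (sin (t - t0) ^ 2 <= 1) by nra. nra.
- exists 1. intros t. apply Rabs_le, COS_bound.
- exists 1. intros t. apply Rabs_le, SIN_bound.
- exists (Rabs c). intros t. lra.
- exists (B + B'). intros t. eapply Rle_trans; [apply Rabs_triang|]. apply Rplus_le_compat; auto.
- exists (B * B'). intros t. rewrite Rabs_mult. apply Rmult_le_compat; auto using Rabs_pos.
Qed.

(** For [z = e^(it)] and [z0 = e^(i t0)] this is [flat 0 (sin (t - t0))]: zero on the half circle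
    clockwise from [z0], positive on the open half circle counterclockwise from it. *)
Definition bump (z0 z : C) : C := RtoC (flat 0 (snd (z * Cconj z0)%C)).

Lemma bump_derseq (z0 : C) : onT z0 -> exists D : nat -> R -> C,
  (forall k, is_derseq k (fun t => bump z0 (expi t)) D) /\
  (forall N, exists B, forall l t, (l <= N)%nat -> Cmod (D l t) <= B).
Proof.
intros Hz0. destruct (expi_surj z0 Hz0) as [t0 ->].
(* Differentiation is chosen on the subset type of the algebra, so it can be iterated and every
   iterate is bounded; the resulting sequence serves all [k] at once. *)
assert (Hstep : forall f : {f | trig_flat t0 f}, exists g : {g | trig_flat t0 g},
  forall t, derivable_pt_lim (proj1_sig f) t (proj1_sig g t)).
{ intros [f Hf]. destruct (trig_flat_derivable t0 f Hf) as [g [Hg H]].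
  exists (exist _ g Hg). exact H. }
apply functional_choice in Hstep. destruct Hstep as [step Hstep].
set (d := fix d n := match n with
  | O => exist (trig_flat t0) _ (tf_flat t0 0) | S n => step (d n) end).
exists (fun n t => RtoC (proj1_sig (d n) t)). split.
- intros k. split.
  + intros t. unfold bump, d, proj1_sig. f_equal. f_equal. rewrite sin_minus. simpl. ring.
  + intros l _. assert (Hc : forall c : R, continuity (fun _ => c)).
    { intros c. apply derivable_continuous, derivable_const. }
    split; [split; simpl; [|apply Hc]|].
    * apply derivable_continuous. intros t. exists (proj1_sig (d (S l)) t). apply (Hstep (d l)).
    * intros _ t. split; simpl; [apply (Hstep (d l))|apply derivable_pt_lim_const].
- intros N. induction N as [|N [B HB]].
  + destruct (trig_flat_bounded t0 _ (proj2_sig (d 0%nat))) as [B HB]. exists B.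
    intros l t Hl. replace l with 0%nat by lia. rewrite Cmod_R. apply HB.
  + destruct (trig_flat_bounded t0 _ (proj2_sig (d (S N)))) as [B' HB']. exists (Rmax B B').
    intros l t Hl. destruct (Nat.eq_dec l (S N)) as [->|].
    * rewrite Cmod_R. eapply Rle_trans; [apply HB'|apply Rmax_r].
    * eapply Rle_trans; [apply HB; lia|apply Rmax_l].
Qed.

(* Uniqueness on a disc, without power series: apply the maximum principle on
   the complement of [D(a,s)] to [h] times powers of an inverse Blaschke factor. *)
Lemma zero_propagation (h : C -> C) (c a : C) (rho s M : R) :
  0 < rho -> 0 < s -> 0 <= M ->
  (forall z, Cmod (z - c) <= rho -> cont_within (fun w => Cmod (w - c) <= rho) h z) ->
  (forall z, Cmod (z - c) < rho -> holo_at h z) ->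
  (forall z, Cmod (z - c) <= rho -> Cmod (h z) <= M) ->
  Cmod (a - c) < rho ->
  (forall z, Cmod (z - a) <= s -> h z = 0) ->
  forall z, Cmod (z - c) < rho -> h z = 0.
Proof.
intros Hrho Hs HM hc hh hM Ha h0 z Hz.
destruct (Rle_lt_dec (Cmod (z - a)) s) as [Hza|Hza]; [auto|].
set (num := fun z => (RtoC (rho ^ 2) - Cconj (a - c) * (z - c))%C).
set (g := fun z => (RtoC (/ rho) * (num z * / (z - a)))%C).
set (K := fun z => Cmod (z - c) <= rho /\ s <= Cmod (z - a)).
set (G := fun z => Cmod (z - c) < rho /\ s < Cmod (z - a)).
assert (Hnz : forall w, s <= Cmod (w - a) -> (w - a <> 0)%C).
{ intros w Hw. apply Cmod_gt_0. lra. }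
assert (Hgh : forall w, s <= Cmod (w - a) -> holo_at g w).
{ intros w Hw. apply (holo_at_mult (fun _ => RtoC (/ rho))); [apply holo_at_const|].
  apply holo_at_mult.
  - apply holo_at_minus; [apply holo_at_const|].
    apply (holo_at_mult (fun _ => Cconj (a - c))); [apply holo_at_const|].
    apply holo_at_minus; [apply holo_at_id|apply holo_at_const].
  - apply holo_at_inv. intros ->. rewrite Cmod_sub_diag in Hw. lra. }
assert (Hg : forall w, s <= Cmod (w - a) -> Cmod (g w) * (rho * Cmod (w - a)) = Cmod (num w)).
{ intros w Hw. unfold g. rewrite !Cmod_mult, Cmod_inv by (apply Hnz; assumption).
  assert (0 < / rho) by (apply Rinv_0_lt_compat; assumption).
  rewrite Cmod_R, Rabs_pos_eq by lra. field. split; lra. }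
(* The right-hand side vanishes on [|w - c| = rho] and is positive inside, so [|g|] is 1 on the
   outer circle and exceeds 1 within. *)
assert (Hnum : forall w, Cmod (num w) ^ 2 - (rho * Cmod (w - a)) ^ 2 =
  (rho ^ 2 - Cmod (w - c) ^ 2) * (rho ^ 2 - Cmod (a - c) ^ 2)).
{ intros w. rewrite Rpow_mult_distr, !Cmod_sqr. unfold num.
  destruct w as [w1 w2], a as [a1 a2], c as [c1 c2]. simpl. ring. }
assert (Ha2 : Cmod (a - c) ^ 2 < rho ^ 2).
{ pose proof (Cmod_ge_0 (a - c)). nra. }
apply (two_constants_zero K G h g M (2 * rho / s)).
- apply Ccompact_inter; [apply closed_disc_compact|apply Copen_not_ge].
- apply Copen_inter; [apply open_disc_open|apply Copen_gt].
- intros w [A B]. split; lra.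
- assumption.
- intros w [A B]. apply (cont_within_subset (fun w => Cmod (w - c) <= rho)); [intros v [V _]; exact V|auto].
- intros w [A B]. apply cont_at_within, holo_at_cont_at, Hgh, B.
- intros w [A B]. apply hh, A.
- intros w [A B]. apply Hgh. lra.
- intros w [A B]. specialize (Hg w B).
  assert (Hn : Cmod (num w) <= 2 * rho ^ 2).
  { unfold num. eapply Rle_trans; [apply Cmod_triangle|]. rewrite Cmod_opp, Cmod_mult, Cmod_conj, Cmod_R.
    rewrite Rabs_pos_eq by apply pow2_ge_0.
    pose proof (Cmod_ge_0 (a - c)). pose proof (Cmod_ge_0 (w - c)). nra. }
  apply Rmult_le_reg_r with (rho * s); [apply Rmult_lt_0_compat; assumption|].
  replace (2 * rho / s * (rho * s)) with (2 * rho ^ 2) by (field; lra).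
  apply Rle_trans with (Cmod (g w) * (rho * Cmod (w - a))); [|lra].
  apply Rmult_le_compat_l; [apply Cmod_ge_0|]. apply Rmult_le_compat_l; lra.
- intros w [A B] nG.
  destruct (Rle_lt_or_eq_dec _ _ B) as [B'|B']; [|right; apply h0; lra].
  destruct (Rle_lt_or_eq_dec _ _ A) as [A'|A']; [exfalso; apply nG; split; assumption|].
  left. split; [auto|].
  assert (Hpos : 0 < rho * Cmod (w - a)) by (apply Rmult_lt_0_compat; lra).
  apply Rmult_le_reg_r with (rho * Cmod (w - a)); [assumption|].
  rewrite Hg by assumption. specialize (Hnum w). rewrite A' in Hnum.
  pose proof (Cmod_ge_0 (num w)). nra.
- split; lra.
- assert (Hpos : 0 < rho * Cmod (z - a)) by (apply Rmult_lt_0_compat; lra).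
  apply Rmult_lt_reg_r with (rho * Cmod (z - a)); [assumption|].
  rewrite Hg by lra. specialize (Hnum z).
  assert (Cmod (z - c) ^ 2 < rho ^ 2) by (pose proof (Cmod_ge_0 (z - c)); nra).
  assert (0 < (rho ^ 2 - Cmod (z - c) ^ 2) * (rho ^ 2 - Cmod (a - c) ^ 2)) by (apply Rmult_lt_0_compat; lra).
  pose proof (Cmod_ge_0 (num z)). nra.
Qed.

(** * Density *)

(* The disc around [p = (1-y, -y)] through [1] meets the unit
   circle near [1] only in the arc where [h] vanishes, so [h] vanishes in its outer part; this part
   contains [a = (1+y/5, -2y/5)], which lies in the disc of radius [y] tangent to the circle
   at [z1 = expi (y/100)], where [h] does not vanish. *)
Lemma one_sided_zero_not_extends (beta : R -> R) (r M : R) (h : C -> C) :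
  (forall x, x <= 0 -> beta x = 0) -> (forall x, 0 < x -> beta x <> 0) ->
  0 < r -> 0 <= M ->
  extends (RtoC 1) r (fun z => RtoC (beta (snd z))) h ->
  (forall z, 1 <= Cmod z -> Cmod (z - 1) < r -> Cmod (h z) <= M) ->
  False.
Proof.
intros beta0 betapos Hr HM (hc & hhol & hT) hM.
set (S := fun w => onT w \/ Omega (RtoC 1) r w).
assert (hh : forall z, 1 < Cmod z -> Cmod (z - 1) < r -> holo_at h z).
{ intros z H1 H2. apply (holomorphic_on_holo_at (Omega (RtoC 1) r)); [apply Omega_open|assumption|].
  split; assumption. }
(* [y <= r / 8] keeps the disc about [p] and the tangent disc inside [D(1, r)]; [y <= 1/2] keeps [p]
   inside the unit disc. *)
set (y := Rmin (r / 8) (1 / 2)).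
assert (Hy : 0 < y) by (apply Rmin_pos; lra).
assert (Hy1 : y <= r / 8) by apply Rmin_l.
assert (Hy2 : y <= 1 / 2) by apply Rmin_r.
set (p := (1 - y, - y) : C).
set (R0 := Cmod (1 - p)).
assert (HR0 : R0 ^ 2 = 2 * y ^ 2) by (unfold R0; rewrite Cmod_sqr; simpl; ring).
assert (HR0p : 0 < R0).
{ apply Cmod_gt_0. intros E. apply (f_equal snd) in E. simpl in E. lra. }
assert (Hp1 : Cmod p < 1).
{ apply Rnot_le_lt; intros Hle. assert (1 ^ 2 <= Cmod p ^ 2) by (apply pow_incr; lra).
  rewrite Cmod_sqr in H. simpl in H. nra. }
assert (Hlens : forall z, 1 <= Cmod z -> Cmod (z - p) <= R0 ->
  Cmod (z - 1) < r /\ (onT z -> snd z <= 0)).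
{ intros z H1 H2.
  assert (K1 : 1 <= Cmod z ^ 2) by nra.
  assert (K2 : Cmod (z - p) ^ 2 <= 2 * y ^ 2).
  { rewrite <- HR0. apply pow_incr. split; [apply Cmod_ge_0|assumption]. }
  rewrite Cmod_sqr in K1, K2.
  change (fst (z - p)%C) with (fst z + - (1 - y)) in K2.
  change (snd (z - p)%C) with (snd z + - - y) in K2.
  split.
  - assert (K3 : Cmod (z - 1) ^ 2 <= 4 * y * Cmod (z - 1)).
    { pose proof (Rabs_fst_le (z - 1)) as F1. pose proof (Rabs_snd_le (z - 1)) as F2.
      change (fst (z - 1)%C) with (fst z + - 1) in F1. change (snd (z - 1)%C) with (snd z + - 0) in F2.
      apply Rabs_le_between in F1. apply Rabs_le_between in F2.
      assert (Cmod (z - 1) ^ 2 <= 2 * y * ((1 - fst z) - snd z)).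
      { rewrite Cmod_sqr. change (fst (z - 1)%C) with (fst z + - 1).
        change (snd (z - 1)%C) with (snd z + - 0). nra. }
      assert ((1 - fst z) - snd z <= 2 * Cmod (z - 1)) by lra. nra. }
    pose proof (Cmod_ge_0 (z - 1)). nra.
  (* Comparing [|z - p| <= |1 - p|] for two points of modulus 1 leaves
     [y snd z <= (1 - y) (fst z - 1) <= 0]. *)
  - intros Tz. apply onT_sqr in Tz. assert (fst z <= 1) by nra. nra. }
assert (hV : forall z, 1 < Cmod z -> Cmod (z - p) < R0 -> h z = 0).
{ intros z Hz1 Hz.
  set (g := fun z => (RtoC R0 * / (z - p))%C).
  assert (Hzp : forall w, 1 <= Cmod w -> 1 - Cmod p <= Cmod (w - p)).
  { intros w Hw. pose proof (Cmod_triangle (w - p) p) as T. replace (w - p + p)%C with w in T by ring. lra. }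
  assert (Hg : forall w, 1 <= Cmod w -> Cmod (g w) = R0 / Cmod (w - p)).
  { intros w Hw. specialize (Hzp w Hw). unfold g. rewrite Cmod_mult, Cmod_inv, Cmod_R, Rabs_pos_eq; try lra.
    apply Cmod_gt_0; lra. }
  assert (Hgh : forall w, 1 <= Cmod w -> holo_at g w).
  { intros w Hw. apply (holo_at_mult (fun _ => RtoC R0)); [apply holo_at_const|].
    apply holo_at_inv. intros ->. lra. }
  apply (two_constants_zero (fun w => Cmod (w - p) <= R0 /\ 1 <= Cmod w)
    (fun w => Cmod (w - p) < R0 /\ 1 < Cmod w) h g M (R0 / (1 - Cmod p))).
  - apply Ccompact_inter; [apply closed_disc_compact|apply Copen_not_ge_1].
  - apply Copen_inter; [apply open_disc_open|apply Copen_gt_1].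
  - intros w [A B]. split; lra.
  - assumption.
  - intros w [A B]. apply (cont_within_subset S).
    + intros v [VA VB]. apply onT_or_Omega; [|apply Hlens]; assumption.
    + apply hc, onT_or_Omega; [|apply Hlens]; assumption.
  - intros w [_ B]. apply cont_at_within, holo_at_cont_at, Hgh, B.
  - intros w [A B]. apply hh; [assumption|]. apply Hlens; lra.
  - intros w [A B]. apply Hgh. lra.
  - intros w [A B]. rewrite Hg by assumption. specialize (Hzp w B).
    apply Rmult_le_compat_l; [lra|]. apply Rinv_le_contravar; lra.
  - intros w [A B] nG. destruct (Hlens w B A) as [Hwr HwT].
    destruct (Rle_lt_or_eq_dec _ _ B) as [B'|B'].
    + left. split; [auto|]. rewrite Hg by assumption.
      destruct (Rle_lt_or_eq_dec _ _ A) as [A'|A']; [exfalso; apply nG; split; assumption|].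
      rewrite A'. right. field. lra.
    + right. assert (Tw : onT w) by (symmetry; exact B').
      rewrite hT by assumption. rewrite beta0; auto.
  - split; lra.
  - rewrite Hg by lra. specialize (Hzp z ltac:(lra)).
    apply Rmult_lt_reg_r with (Cmod (z - p)); [lra|].
    unfold Rdiv. rewrite Rmult_assoc, Rinv_l by lra. lra. }
(* [a] is within [9/10 y] of [1 + y], and turning the point of tangency from 1 to [z1] moves the
   centre by at most [(1 + y) 2 theta <= 3/100 y], so [a] stays in the tangent disc. *)
set (theta := y / 100). assert (Hth : 0 < theta) by (unfold theta; lra).
set (z1 := expi theta : C).
assert (Tz1 : Cmod z1 = 1) by apply onT_expi.
assert (Hsin : 0 < sin theta).
{ apply sin_gt_0; [assumption|]. pose proof PI2_1. unfold theta. lra. }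
assert (Hz1 : Cmod (z1 - 1) <= 2 * theta).
{ eapply Rle_trans; [apply Cmod_le_abs2|].
  change (Rabs (cos theta + - 1) + Rabs (sin theta + - 0) <= 2 * theta).
  assert (sin theta < theta) by (apply sin_lt_x; assumption).
  pose proof (COS_bound theta).
  assert (1 - theta <= cos theta).
  { pose proof (sin2_cos2 theta) as E; unfold Rsqr in E.
    assert (0 <= cos theta). { apply cos_ge_0; pose proof PI2_1; unfold theta in *; lra. }
    assert (theta <= 1) by (unfold theta; lra). nra. }
  rewrite (Rabs_left1 (cos theta + - 1)) by lra. rewrite (Rabs_pos_eq (sin theta + - 0)) by lra. lra. }
set (a := (1 + y / 5, - (2 * y / 5)) : C).
assert (Ha1 : 1 < Cmod a).
{ apply Rnot_le_lt; intros Hle. assert (Cmod a ^ 2 <= 1 ^ 2) by (apply pow_incr; split; [apply Cmod_ge_0|assumption]).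
  rewrite Cmod_sqr in H. simpl in H. nra. }
assert (Hap : Cmod (a - p) < R0).
{ apply Rnot_le_lt; intros Hle. assert (R0 ^ 2 <= Cmod (a - p) ^ 2) by (apply pow_incr; lra).
  rewrite HR0, Cmod_sqr in H. simpl in H. nra. }
set (c := (RtoC (1 + y) * z1)%C).
assert (Hac : Cmod (a - c) < y).
{ assert (K1 : Cmod (a - RtoC (1 + y)) <= 9 / 10 * y).
  { apply Rnot_lt_le; intros Hlt. assert ((9 / 10 * y) ^ 2 <= Cmod (a - RtoC (1 + y)) ^ 2) by (apply pow_incr; lra).
    rewrite Cmod_sqr in H. simpl in H. nra. }
  assert (K2 : Cmod (RtoC (1 + y) - c) <= (1 + y) * (2 * theta)).
  { replace (RtoC (1 + y) - c)%C with (RtoC (1 + y) * - (z1 - 1))%C by (unfold c; ring).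
    rewrite Cmod_mult, Cmod_opp, Cmod_R, Rabs_pos_eq by lra. apply Rmult_le_compat_l; lra. }
  pose proof (Cmod_sub_triangle a (RtoC (1 + y)) c). unfold theta in K2. nra. }
assert (Hcz1 : Cmod (c - z1) = y).
{ replace (c - z1)%C with (RtoC y * z1)%C by (unfold c; rewrite RtoC_plus; ring).
  rewrite Cmod_mult, Tz1, Cmod_R, Rabs_pos_eq; lra. }
assert (Hc : Cmod c = 1 + y).
{ unfold c. rewrite Cmod_mult, Tz1, Cmod_R, Rabs_pos_eq; lra. }
assert (Hdisc : forall z, Cmod (z - c) <= y -> 1 <= Cmod z /\ Cmod (z - 1) < r).
{ intros z Hz. split.
  - pose proof (Cmod_triangle z (c - z)) as T. replace (z + (c - z))%C with c in T by ring.
    rewrite (Cmod_sub_sym c z) in T. lra.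
  - pose proof (Cmod_sub_triangle z c 1). pose proof (Cmod_sub_triangle c z1 1).
    unfold theta in Hz1. lra. }
assert (Hdisc1 : forall z, Cmod (z - c) < y -> 1 < Cmod z).
{ intros z Hz. pose proof (Cmod_triangle z (c - z)) as T. replace (z + (c - z))%C with c in T by ring.
  rewrite (Cmod_sub_sym c z) in T. lra. }
destruct (Copen_inter _ _ (open_disc_open p R0) Copen_gt_1 a (conj Hap Ha1)) as [s [Hs Hsa]].
assert (hD : forall z, Cmod (z - c) < y -> h z = 0).
{ apply (zero_propagation h c a y (s / 2) M); try lra.
  - intros z Hz. apply (cont_within_subset S).
    + intros w Hw. destruct (Hdisc w Hw). apply onT_or_Omega; assumption.
    + destruct (Hdisc z Hz). apply hc, onT_or_Omega; assumption.
  - intros z Hz. apply hh; [auto|]. apply Hdisc; lra.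
  - intros z Hz. destruct (Hdisc z Hz). apply hM; assumption.
  - intros z Hz. destruct (Hsa z ltac:(lra)). apply hV; assumption. }
assert (Hz1r : Cmod (z1 - 1) < r) by (unfold theta in Hz1; lra).
assert (Hne : h z1 <> 0).
{ rewrite hT by assumption. change (snd z1) with (sin theta). intros E.
  apply (f_equal fst) in E. simpl in E. exact (betapos _ Hsin E). }
apply Hne, Cmod_eq_0. apply NNPP; intros Hpos.
pose proof (Cmod_ge_0 (h z1)).
destruct (cont_withinE _ _ _ (hc z1 (or_introl Tz1)) (Cmod (h z1)) ltac:(lra)) as [d [Hd Hcd]].
(* The points [(1 + x) z1] with [0 < x <= y] lie in the tangent disc, where [h] is 0, and approach
   [z1] as [x] shrinks. *)
set (x := Rmin (d / 2) y).
assert (Hx : 0 < x) by (apply Rmin_pos; lra).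
assert (Hx1 : x <= d / 2) by apply Rmin_l. assert (Hx2 : x <= y) by apply Rmin_r.
set (w := (RtoC (1 + x) * z1)%C).
assert (Hwc : Cmod (w - c) < y).
{ replace (w - c)%C with (RtoC (x - y) * z1)%C by (unfold w, c; rewrite RtoC_minus, !RtoC_plus; ring).
  rewrite Cmod_mult, Tz1, Cmod_R, Rabs_left1; lra. }
assert (Hwz : Cmod (w - z1) < d).
{ replace (w - z1)%C with (RtoC x * z1)%C by (unfold w; rewrite RtoC_plus; ring).
  rewrite Cmod_mult, Tz1, Cmod_R, Rabs_pos_eq; lra. }
destruct (Hdisc w ltac:(lra)) as [Hw1 Hwr].
specialize (Hcd w (onT_or_Omega _ _ _ Hw1 Hwr) Hwz).
rewrite (hD w Hwc) in Hcd. replace (0 - h z1)%C with (- h z1)%C in Hcd by ring.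
rewrite Cmod_opp in Hcd. lra.
Qed.

(** Reduces the bump argument to [z0 = 1], where the discs have explicit coordinates. *)
Lemma extends_rotate (z0 : C) (r : R) (u lam : C -> C) :
  onT z0 -> extends z0 r u lam ->
  extends (RtoC 1) r (fun z => u (z0 * z)%C) (fun z => lam (z0 * z)%C).
Proof.
intros Hz0 (H1 & H2 & H3). change (Cmod z0 = 1) in Hz0.
assert (Hmod : forall z, Cmod (z0 * z) = Cmod z) by (intros z; rewrite Cmod_mult, Hz0; ring).
assert (Hsub : forall z w, Cmod (z0 * z - z0 * w) = Cmod (z - w)).
{ intros z w. rewrite <- (Hmod (z - w)%C). f_equal. ring. }
assert (Hsub1 : forall z, Cmod (z0 * z - z0) = Cmod (z - 1)).
{ intros z. rewrite <- (Hmod (z - 1)%C). f_equal. ring. }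
assert (HT : forall z, onT z -> onT (z0 * z)%C) by (intros z Hz; change (Cmod (z0 * z) = 1); rewrite Hmod; exact Hz).
assert (HO : forall z, Omega (RtoC 1) r z -> Omega z0 r (z0 * z)%C).
{ intros z [A B]. change (Cmod (z - 1) < r) in A. change (1 < Cmod z) in B. split.
  - change (Cmod (z0 * z - z0) < r). rewrite Hsub1. assumption.
  - change (1 < Cmod (z0 * z)). rewrite Hmod. assumption. }
assert (HS : forall z, onT z \/ Omega (RtoC 1) r z -> onT (z0 * z)%C \/ Omega z0 r (z0 * z)%C).
{ intros z [Hz|Hz]; auto. }
split; [|split].
- intros z Hz eps Heps. destruct (cont_withinE _ _ _ (H1 _ (HS z Hz)) eps Heps) as [d [Hd H]].
  exists d; split; [assumption|]. intros w Hw Hwz. apply H; [auto|]. rewrite Hsub. exact Hwz.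
- apply holo_at_holomorphic_on. intros z Hz.
  destruct (holomorphic_on_holo_at _ _ _ (Omega_open z0 r) H2 (HO z Hz)) as [l Hl].
  destruct (holo_at_mult (fun _ => z0) (fun z => z) z (holo_at_const z0 z) (holo_at_id z)) as [m Hm].
  eexists. apply (is_derive_comp (K := C_AbsRing) (V := AbsRing_NormedModule C_AbsRing) lam (fun z => (z0 * z)%C) z l m Hl Hm).
- intros z Hz Hzr. apply H3; [auto|]. rewrite Hsub1. assumption.
Qed.

Lemma bump_not_extends (z0 : C) (r : R) (lam : C -> C) :
  onT z0 -> 0 < r -> ~ extends z0 r (bump z0) lam.
Proof.
intros Hz0 Hr H. destruct (extends_bounded z0 r _ lam Hz0 Hr H) as (n & F & HF & HB).
pose proof (pos_INR n).
apply (extends_rotate _ _ _ _ Hz0) in HF. change (Cmod z0 = 1) in Hz0.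
apply (one_sided_zero_not_extends (flat 0) (/ (INR n + 1)) (INR n) (fun z => F (z0 * z)%C)).
- apply flat_nonpos.
- intros x Hx. rewrite flat_pos by assumption. simpl. pose proof (exp_pos (- / x)). lra.
- apply Rinv_0_lt_compat. lra.
- assumption.
- destruct HF as (H1 & H2 & H3). split; [exact H1|split; [exact H2|]].
  intros z Hz Hzr. rewrite H3 by assumption. unfold bump. f_equal. f_equal.
  replace (z0 * z * Cconj z0)%C with (z * (z0 * Cconj z0))%C by ring.
  rewrite <- Cmod2_conj, Hz0, pow1, Cmult_1_r. reflexivity.
- intros z Hz Hzr. apply HB.
  + rewrite Cmod_mult, Hz0. lra.
  + replace (z0 * z - z0)%C with (z0 * (z - 1))%C by ring. rewrite Cmod_mult, Hz0. lra.
Qed.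

(** Combined in this form because the bump is a scaled difference of the perturbed and the original
    function. *)
Lemma extends_linear (z0 : C) (r : R) (b : C) (u v lam mu : C -> C) :
  extends z0 r u lam -> extends z0 r v mu ->
  extends z0 r (fun z => b * (v z - u z))%C (fun z => b * (mu z - lam z))%C.
Proof.
intros (H1 & H2 & H3) (K1 & K2 & K3). split; [|split].
- intros z Hz. apply (cont_within_mult _ (fun _ => b)); [apply cont_at_within, cont_at_const|].
  apply cont_within_minus; auto.
- apply holo_at_holomorphic_on. intros z Hz.
  apply (holo_at_mult (fun _ => b)); [apply holo_at_const|].
  apply holo_at_minus; apply (holomorphic_on_holo_at (Omega z0 r)); auto using Omega_open.
- intros z Hz Hzr. rewrite H3, K3 by assumption. reflexivity.
Qed.

Lemma derseq_plus_scal (k : option nat) (f g : R -> C) (Df Dg : nat -> R -> C) (b : R) :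
  is_derseq k f Df -> is_derseq k g Dg ->
  is_derseq k (fun t => f t + RtoC b * g t)%C (fun l t => Df l t + RtoC b * Dg l t)%C.
Proof.
intros [F0 F] [G0 G]. split; [intros t; rewrite F0, G0; reflexivity|].
assert (Ef : forall x y : C, fst (x + RtoC b * y)%C = fst x + b * fst y) by (intros; simpl; ring).
assert (Es : forall x y : C, snd (x + RtoC b * y)%C = snd x + b * snd y) by (intros; simpl; ring).
intros l Hl. destruct (F l Hl) as [[F1 F2] F3]. destruct (G l Hl) as [[G1 G2] G3].
split; [split|].
- intros t. apply (continuity_pt_ext (fun t => fst (Df l t) + b * fst (Dg l t))); [intros; symmetry; apply Ef|].
  apply continuity_pt_plus; [apply F1|]. apply continuity_pt_scal, G1.
- intros t. apply (continuity_pt_ext (fun t => snd (Df l t) + b * snd (Dg l t))); [intros; symmetry; apply Es|].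
  apply continuity_pt_plus; [apply F2|]. apply continuity_pt_scal, G2.
- intros HS t. destruct (F3 HS t) as [A1 A2]. destruct (G3 HS t) as [B1 B2]. split.
  + rewrite Ef. apply is_derive_Reals.
    apply (is_derive_ext (fun t => fst (Df l t) + b * fst (Dg l t))); [intros; symmetry; apply Ef|].
    apply is_derive_Reals. apply derivable_pt_lim_plus; [exact A1|].
    apply derivable_pt_lim_scal, B1.
  + rewrite Es. apply is_derive_Reals.
    apply (is_derive_ext (fun t => snd (Df l t) + b * snd (Dg l t))); [intros; symmetry; apply Es|].
    apply is_derive_Reals. apply derivable_pt_lim_plus; [exact A2|].
    apply derivable_pt_lim_scal, B2.
Qed.

Lemma U2_dense (z0 : C) (k : option nat) : onT z0 -> Ck_dense k (U2 z0 k).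
Proof.
intros Hz0. split; [intros u [Hu _]; exact Hu|].
intros u Hu N HN eps Heps.
destruct (classic (exists r F, 0 < r /\ extends z0 r u F)) as [(r & F & Hr & HF)|Hne].
2:{ exists u. split; [apply U2_iff; tauto|]. apply Ck_close_refl; [assumption|lra]. }
destruct (bump_derseq z0 Hz0) as (Dw & HDw & HBw). destruct (HBw N) as [B HB].
destruct Hu as [Du HDu].
assert (HB0 : 0 <= B).
{ eapply Rle_trans; [apply (Cmod_ge_0 (Dw 0%nat 0))|]. apply HB. lia. }
(* [B] bounds the derivatives of the bump up to order [N], so [b B < eps]; the summand 1 covers
   [B = 0]. *)
set (b := eps / (B + 1)).
assert (Hb : 0 < b) by (apply Rdiv_lt_0_compat; lra).
set (v := fun z => (u z + RtoC b * bump z0 z)%C).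
pose proof (derseq_plus_scal k _ _ Du Dw b HDu (HDw k)) as HDv.
exists v. split.
- apply U2_iff. split; [eexists; exact HDv|]. intros (r' & F' & Hr' & HF').
  (* The extensions of [u] and [v] are brought to a common radius; their difference divided by [b]
     would extend the bump. *)
  set (e := Rmin r r'). assert (He : 0 < e) by (apply Rmin_pos; assumption).
  apply (extends_shrink _ _ e) in HF; [|apply Rmin_l].
  apply (extends_shrink _ _ e) in HF'; [|apply Rmin_r].
  pose proof (extends_linear _ _ (RtoC (/ b)) _ _ _ _ HF HF') as (K1 & K2 & K3).
  eapply (bump_not_extends z0 e _ Hz0 He).
  split; [exact K1|split; [exact K2|]]. intros z Hz Hzr. rewrite K3 by assumption.
  unfold v. transitivity (RtoC (/ b) * RtoC b * bump z0 z)%C; [ring|].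
  rewrite <- RtoC_mult, Rinv_l by lra. ring.
- intros Du' Dv' Hu' Hv' l Hl t.
  assert (Hlk : le_k l k) by (apply (le_k_trans l N); assumption).
  rewrite (derseq_unique k _ Du' Du l Hu' HDu Hlk), (derseq_unique k _ Dv' _ l Hv' HDv Hlk).
  change (Cmod (Du l t - (Du l t + RtoC b * Dw l t)) <= eps).
  replace (Du l t - (Du l t + RtoC b * Dw l t))%C with (- (RtoC b * Dw l t))%C by ring.
  rewrite Cmod_opp, Cmod_mult, Cmod_R, Rabs_pos_eq by lra.
  apply Rle_trans with (b * B); [apply Rmult_le_compat_l; [lra|auto]|].
  replace eps with (b * (B + 1)) by (unfold b; field; lra).
  apply Rmult_le_compat_l; lra.
Qed.

Theorem theorem3p12 (z0 : Cplx) (k : option nat) (hz0 : onT z0) :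
  Ck_dense k (U2 z0 k) /\ Ck_Gdelta k (U2 z0 k).
Proof.
split; [apply U2_dense|apply U2_Gdelta]; exact hz0.
Qed.
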